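(* Let $Q$ be a concave BUM function, let $C_1,\dots,C_n$ be independent with $C_i$ uniformly distributed on $[\underline{c}_i,\overline{c}_i]$, $\underline{c}_i\ge 0$, let $\hat{c}_i=\mathbb{E}[C_i]$, and let $\gamma\ge\frac12$ be a constant such that $\hat{c}_i\ge\gamma(\overline{c}_i-\underline{c}_i)$ for each $i\in\{1,\dots,n\}$. Let $\beta=\min\{\beta_V,\beta_H\}$, where $$\beta_V=\frac{1}{\sqrt{12}}\int_0^1\sqrt{t^{-1}}\,dQ(t),\qquad \beta_H=\frac{\sqrt2}{2}\int_0^1\sqrt{\ln t^{-1}}\,dQ(t).$$ If the value of $\beta$ and an optimal solution to the problem $$\min_{\boldsymbol{x}\in\mathcal{X}}\ \hat{\boldsymbol{c}}^\top\boldsymbol{x}+\beta\sqrt{\sum_{i=1}^n(\overline{c}_i-\underline{c}_i)^2x_i^2}$$ can be computed in polynomial time, then the problem $\min_{\boldsymbol{x}\in\mathcal{X}}\rho_Q(\boldsymbol{C}^\top\boldsymbol{x})$ is approximable within $1+\beta/\gamma$.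
   Context: A basic unit monotone (BUM) function is a function $Q:[0,1]\to[0,1]$ with $Q(0)=0$, $Q(1)=1$ and $Q(x)\ge Q(y)$ for $x>y$. For a random variable $Y$ with CDF $F_Y$, $\mathrm{VaR}_t(Y)=\inf\{y\in\mathbb{R}: F_Y(y)\ge t\}$ for $t\in(0,1]$ and $\mathrm{VaR}_0(Y)=\inf\{y\in\mathbb{R}:F_Y(y)>0\}$. The distortion risk measure is the Riemann–Stieltjes integral $\rho_Q(Y)=\int_0^1 \mathrm{VaR}_{1-t}(Y)\,dQ(t)$. $\mathcal{X}\subseteq\mathbb{R}^n_+$ is a set of feasible solutions, $\boldsymbol{C}=(C_1,\dots,C_n)^\top$ and $\hat{\boldsymbol{c}}=(\hat{c}_1,\dots,\hat{c}_n)$. The integrals defining $\beta_V,\beta_H$ are (possibly improper) Stieltjes integrals with values in $[0,+\infty]$, the integrands being $+\infty$ at $t=0$ (so a jump of $Q$ at $0$ makes them infinite); it is assumed that $\beta<\infty$. A problem $\min_{\boldsymbol{x}\in\mathcal{X}}f(\boldsymbol{x})$ is approximable within $\kappa$ if there is a polynomial-time algorithm that outputs $\boldsymbol{x}^*\in\mathcal{X}$ with $f(\boldsymbol{x}^* )\le\kappa f(\boldsymbol{x})$ for all $\boldsymbol{x}\in\mathcal{X}$. *)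

(* Defs.v *)
From HB Require Import structures.
From mathcomp Require Import all_boot all_order all_algebra.
From mathcomp Require Import all_classical all_reals all_analysis.
From mathcomp Require Import measurable_realfun.
Import numFieldNormedType.Exports.

Set Implicit Arguments.
Unset Strict Implicit.
Unset Printing Implicit Defensive.

Import Order.TTheory GRing.Theory Num.Theory.
Local Open Scope classical_set_scope.
Local Open Scope ring_scope.

Section Stieltjes.
Context {R : realType}.
Implicit Types (f g : R -> R) (a b v : R) (s : seq R) (xi : nat -> R).

(* As in [itv_partition], the k-th cell of the partition a :: s is
   [nth 0 (a :: s) k, nth 0 s k], and xi k is its tag. *)
Definition is_tagging s xi a :=
  forall k, (k < size s)%N -> xi k \in `[nth 0 (a :: s) k, nth 0 s k].

Definition mesh_lt s a (delta : R) :=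
  forall k, (k < size s)%N -> nth 0 s k - nth 0 (a :: s) k < delta.

Definition RS_sum f g a s xi : R :=
  \sum_(k < size s) f (xi k) * (g (nth 0 s k) - g (nth 0 (a :: s) k)).

Definition is_RS_integral f g a b v :=
  forall eps : R, 0 < eps -> exists2 delta : R, 0 < delta &
    forall s xi, itv_partition a b s -> is_tagging s xi a -> mesh_lt s a delta ->
      `|RS_sum f g a s xi - v| < eps.

(* The Riemann-Stieltjes integral of f with respect to g over [a, b]
   (0 if it does not exist). *)
Definition RS_integral f g a b : R := xget 0 [set v | is_RS_integral f g a b v].

(* Stieltjes integral over [0, 1] of an integrand f >= 0 that is finite on
   ]0, 1] and +oo at 0; the value of the real function f at 0 is irrelevant.
   With the convention +oo * 0 = 0, the first term is the contribution of the
   point 0, and it is infinite exactly when g jumps there. *)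
Definition improper_RS_integral f g : \bar R :=
  (+oo * (lim (g t @[t --> 0^'+]) - g 0)%:E
   + lim ((RS_integral f g a 1)%:E @[a --> 0^'+]))%E.

End Stieltjes.

Section Distortion.
Context {R : realType}.

Definition BUM (Q : R -> R) :=
  [/\ {in `[0, 1], forall x, Q x \in `[0, 1]}, Q 0 = 0, Q 1 = 1
    & {in `[0, 1] &, {homo Q : x y / x <= y}}].

Definition concave_on01 (Q : R -> R) :=
  @convex_function R R^o `[0, 1]%classic (fun x => - Q x).

Definition betaV (Q : R -> R) : \bar R :=
  (((Num.sqrt 12)^-1)%:E
   * improper_RS_integral (fun t => Num.sqrt t^-1) Q)%E.

Definition betaH (Q : R -> R) : \bar R :=
  ((Num.sqrt 2 / 2)%:E
   * improper_RS_integral (fun t => Num.sqrt (ln t^-1)) Q)%E.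

Context {d : measure_display} {T : measurableType d} {P : probability T R}.

(* [inf] is the real infimum, so this is meaningful when the sets below are
   nonempty and bounded below, e.g. for every t in [0, 1] when Y is bounded. *)
Definition VaR (Y : {RV P >-> R}) (t : R) : R :=
  if t == 0 then inf [set y | (0 < cdf Y y)%E]
  else inf [set y | (t%:E <= cdf Y y)%E].

Definition rho (Q : R -> R) (Y : {RV P >-> R}) : R :=
  RS_integral (fun t => VaR Y (1 - t)) Q 0 1.

(* A one-point interval carries the Dirac mass. *)
Definition uniform_on (a b : R) (Y : {RV P >-> R}) :=
  (exists ab : a < b,
     forall A, measurable A -> distribution P Y A = uniform_prob ab A)
  \/ (a = b /\ forall A, measurable A -> distribution P Y A = \d_a A).

Definition mutually_independent (n : nat) (C : 'I_n -> {RV P >-> R}) :=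
  forall (J : {set 'I_n}) (A : 'I_n -> set R),
    (forall j, measurable (A j)) ->
    P (\bigcap_(j in [set` J]) C j @^-1` A j)
    = (\prod_(j in J) P (C j @^-1` A j))%E.

Definition linear_cost (n : nat) (C : 'I_n -> {RV P >-> R}) (x : 'rV[R]_n) :
    {RV P >-> R} :=
  \sum_(i < n) scale_mfun (x ord0 i) (C i).

End Distortion.

(* Deterministic Turing machines with one two-way infinite tape. The tape
   symbols are the blank None, the bits, and finitely many auxiliary symbols.
   A transition None means that the machine halts. *)
Inductive move := MoveL | MoveR | Stay.

Definition symbol (aux : finType) : Type := option (bool + aux).

Record machine := Machine {
  state : finType;
  aux : finType;
  start : state;
  trans : state -> symbol aux -> option (state * symbol aux * move) }.

(* The tape is the left part, listed from the head outwards, and the right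
   part, whose first item is the scanned cell; all other cells are blank. *)
Record config (M : machine) := Config {
  cstate : state M;
  cleft : seq (symbol (aux M));
  cright : seq (symbol (aux M)) }.

Definition scanned (M : machine) (c : config M) : symbol (aux M) :=
  head None (cright c).

Definition halted (M : machine) (c : config M) : bool :=
  ~~ trans (cstate c) (scanned c).

Definition step (M : machine) (c : config M) : config M :=
  let l := cleft c in
  let r := behead (cright c) in
  match trans (cstate c) (scanned c) with
  | None => c
  | Some (q, a, MoveL) => Config q (behead l) (head None l :: a :: r)
  | Some (q, a, MoveR) => Config q (a :: l) r
  | Some (q, a, Stay) => Config q l (a :: r)
  end.

Definition initial (M : machine) (w : seq bool) : config M :=
  Config (start M) [::] [seq Some (inl b) | b <- w].

Fixpoint leading_bits (A : finType) (r : seq (symbol A)) : seq bool :=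
  if r is Some (inl b) :: r' then b :: leading_bits r' else [::].

(* On input w, M halts within t steps and outputs v: the bits read from the
   head rightwards, up to the first cell that holds no bit. *)
Definition outputs (M : machine) (t : nat) (w v : seq bool) :=
  let c := iter t (@step M) (initial M w) in
  halted c /\ leading_bits (cright c) = v.

(* Search problem over the instances in I, given to the machine through enc;
   spec i v means that v is an acceptable answer on instance i. *)
Definition polytime_solvable (I : Type) (enc : I -> seq bool)
    (spec : I -> seq bool -> Prop) :=
  exists (M : machine) (p : {poly nat}), forall i : I,
    exists2 v, outputs M p.[size (enc i)] (enc i) v & spec i v.

(* A minimisation problem consists of a feasible set X i and an objective f i
   for each instance i : I. The word w denotes the number real_of w and the
   vector vec_of m w of dimension m, if any. *)
Definition polytime_computable_value (R : realType) (I : Type)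
    (enc : I -> seq bool) (real_of : seq bool -> option R) (val : I -> R) :=
  polytime_solvable enc (fun i w => real_of w = Some (val i)).

Definition polytime_optimizable (R : realType) (I : Type)
    (enc : I -> seq bool) (vec_of : forall m, seq bool -> option 'rV[R]_m)
    (n : I -> nat) (X : forall i, set 'rV[R]_(n i))
    (f : forall i, 'rV[R]_(n i) -> R) :=
  polytime_solvable enc (fun i w => exists x, [/\ vec_of (n i) w = Some x,
    X i x & forall y, X i y -> f i x <= f i y]).

Definition approximable_within (R : realType) (I : Type)
    (enc : I -> seq bool) (vec_of : forall m, seq bool -> option 'rV[R]_m)
    (n : I -> nat) (X : forall i, set 'rV[R]_(n i))
    (f : forall i, 'rV[R]_(n i) -> R) (kappa : I -> R) :=
  polytime_solvable enc (fun i w => exists x, [/\ vec_of (n i) w = Some x,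
    X i x & forall y, X i y -> f i x <= kappa i * f i y]).

(* Main.v *)
Require Import Defs.
From HB Require Import structures.
From mathcomp Require Import all_boot all_order all_algebra.
From mathcomp Require Import all_classical all_reals all_analysis.
From mathcomp Require Import measurable_realfun ring lra.
Import numFieldNormedType.Exports.
Import Order.TTheory GRing.Theory Num.Theory.
Local Open Scope classical_set_scope.
Local Open Scope ring_scope.

(* With m the mean and S = sum_j (hi_j - lo_j)^2 x_j^2 for the cost Y of x,
   one shows m <= rho_Q(Y) <= m + beta sqrt S; since sqrt S <= m / gamma, the
   optimal solution of the surrogate problem is the required approximation.

   Lower bound: Q t >= t by concavity, and E min(Y, v) changes by at most
   (u - v) P(Y > v) when v increases to u, so by induction on the partition
   every Riemann-Stieltjes sum with left tags is at least E Y.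

   Upper bound: sinh u <= u exp(u^2 / 6) makes a uniform variable sub-Gaussian
   with variance proxy (hi - lo)^2 / 12, so by independence and Chernoff's bound
   VaR_(1-t)(Y) <= m + sqrt (S ln(1/t) / 6). This is below both
   m + sqrt S sqrt (1/t) / sqrt 12 (as ln u <= u / 2) and
   m + sqrt S sqrt 2 / 2 sqrt (ln (1/t)), the integrands of beta_V and beta_H.

   A finite beta excludes a jump of Q at 0; concavity then gives
   Q y - Q x <= Q (y - x), so Q is uniformly continuous and monotone functions,
   such as VaR, are integrable against it without any continuity. *)

(** * Riemann-Stieltjes integration of monotone functions *)

Section RiemannStieltjes.
Context {R : realType}.
Implicit Types (f g h : R -> R) (a b c d e m k x y v w : R).
Implicit Types (s : seq R) (xi : nat -> R).

Lemma RS_sum_nil f g a xi : RS_sum f g a [::] xi = 0.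
Proof. by rewrite /RS_sum big_ord0. Qed.

Lemma RS_sum_cons f g a x s xi :
  RS_sum f g a (x :: s) xi =
  f (xi 0%N) * (g x - g a) + RS_sum f g x s (xi \o succn).
Proof. by rewrite /RS_sum /= big_ord_recl. Qed.

Lemma is_tagging_cons a x s xi :
  is_tagging (x :: s) xi a <->
  xi 0%N \in `[a, x] /\ is_tagging s (xi \o succn) x.
Proof.
split=> [H|[H0 H]]; first by split=> [|k ks]; [exact: (H 0%N)|exact: (H k.+1)].
by case=> [|k] //; exact: H.
Qed.

Lemma mesh_lt_cons a x s e :
  mesh_lt (x :: s) a e <-> x - a < e /\ mesh_lt s x e.
Proof.
split=> [H|[H0 H]]; first by split=> [|k ks]; [exact: (H 0%N)|exact: (H k.+1)].
by case=> [|k] //; exact: H.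
Qed.

Lemma itv_partition_consP a b x s :
  itv_partition a b (x :: s) <-> a < x /\ itv_partition x b s.
Proof.
rewrite /itv_partition /=; split=> [[/andP[ax sx] sb]|[ax [sx sb]]] //.
by split=> //; rewrite ax.
Qed.

(** The tag of each cell is its left endpoint, so for f nonincreasing and g nondecreasing this is an
    upper Darboux sum. *)
Definition left_sum f g a s := RS_sum f g a s (nth 0 (a :: s)).

Lemma left_sum_cons f g a x s :
  left_sum f g a (x :: s) = f a * (g x - g a) + left_sum f g x s.
Proof. by rewrite /left_sum RS_sum_cons. Qed.

Lemma left_tagging a b s : itv_partition a b s ->
  is_tagging s (nth 0 (a :: s)) a.
Proof.
elim: s a => [//|x s IH] a /itv_partition_consP[ax /IH xs].
by apply/is_tagging_cons; split=> //=; rewrite in_itv /= lexx ltW.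
Qed.

Lemma fine_itv_partition a b e : a < b -> 0 < e ->
  exists2 s, itv_partition a b s & mesh_lt s a e.
Proof.
(* Steps of length e / 2 keep the mesh strictly below e; the induction is on their number. *)
move=> ab e0; have [n] : exists n : nat, b - a <= n%:R * (e / 2).
  exists (Num.bound ((b - a) / (e / 2))); rewrite -ler_pdivrMr ?divr_gt0//.
  by apply/ltW/archi_boundP; rewrite !divr_ge0 ?subr_ge0// ltW.
elim: n a ab => [|n IH] a ab; first by rewrite mul0r subr_le0 leNgt ab.
move=> bn; have [be|be] := leP b (a + e / 2).
  exists [:: b]; first exact: itv_partition1.
  by apply/mesh_lt_cons; split=> //; lra.
have [|s sP sm] := IH _ be; first by rewrite mulrSr in bn; lra.
exists (a + e / 2 :: s); first by apply/itv_partition_consP; split=> //; lra.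
by apply/mesh_lt_cons; split=> //; lra.
Qed.

(** One partition finer than both thresholds serves the two integrals at once, so that inequalities
    between left sums pass to the limit. *)
Lemma RS_integral_left_sums f g h a b v w e :
    a < b -> 0 < e -> is_RS_integral f g a b v -> is_RS_integral h g a b w ->
  exists s, [/\ itv_partition a b s, `|left_sum f g a s - v| < e
                & `|left_sum h g a s - w| < e].
Proof.
move=> ab e0 /(_ _ e0)[d1 d10 fv] /(_ _ e0)[d2 d20 hw].
have [|s sP sm] := fine_itv_partition a b (Num.min d1 d2) ab.
  by rewrite lt_min d10.
exists s; split=> //.
  apply: fv => //; first exact: left_tagging sP.
  by move=> k ks; rewrite (lt_le_trans (sm _ ks))// ge_min lexx.
apply: hw => //; first exact: left_tagging sP.
by move=> k ks; rewrite (lt_le_trans (sm _ ks))// ge_min lexx orbT.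
Qed.

(** Left tags never reach b, so the bound on f is asked on [[a, b[] only. The bounds on VaR are
    later proved for t < 1 and fit this form. *)
Lemma left_sum_le_affine f g h a b s m k : itv_partition a b s -> 
    {in `[a, b] &, {homo g : x y / x <= y}} ->
    {in `[a, b[, forall x, f x <= m + k * h x} ->
  left_sum f g a s <= m * (g b - g a) + k * left_sum h g a s.
Proof.
elim: s a => [|x s IH] a.
  by move=> /itv_partition_nil <- _ _;
    rewrite /left_sum !RS_sum_nil subrr !mulr0 addr0.
move=> /itv_partition_consP[ax xs] gh fh; have xb := itv_partition_le xs.
have sub y : y \in `[x, b] -> y \in `[a, b].
  by rewrite !in_itv /= => /andP[/(le_trans (ltW ax)) -> ->].
have {}IH : left_sum f g x s <= m * (g b - g x) + k * left_sum h g x s.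
  apply: IH => // [y z /sub yb /sub zb|y]; first exact: gh.
  rewrite in_itv => /andP[xy yb]; apply: fh.
  by rewrite in_itv /= (le_trans (ltW ax)).
rewrite !left_sum_cons.
have : f a <= m + k * h a by apply: fh; rewrite in_itv /= lexx (lt_le_trans ax).
have : 0 <= g x - g a.
  rewrite subr_ge0 gh ?in_itv /= ?lexx ?xb ?(ltW ax)//.
  by rewrite (le_trans (ltW ax)).
by nra.
Qed.

Lemma is_RS_integral_le_affine f g h a b v w m k : a < b -> 0 <= k ->
    {in `[a, b] &, {homo g : x y / x <= y}} ->
    {in `[a, b[, forall x, f x <= m + k * h x} ->
    is_RS_integral f g a b v -> is_RS_integral h g a b w ->
  v <= m * (g b - g a) + k * w.
Proof.
move=> ab k0 gh fh fv hw; apply/ler_addgt0Pr => e e0.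
(* Both left sums are taken within e / (k + 1) of their limits: the errors e' and k * e' then add up
   to e. *)
have k1 : 0 < k + 1 by rewrite ltr_wpDl.
have [s [sP]] := RS_integral_left_sums _ _ _ _ _ _ _ _ ab (divr_gt0 e0 k1) fv
  hw.
have := left_sum_le_affine _ _ _ _ _ _ _ _ sP gh fh.
set e' := e / (k + 1);
  have -> : e = (k + 1) * e' by rewrite mulrC divfK// gt_eqF.
by rewrite !ltr_distl => le /andP[? _] /andP[_ ?]; nra.
Qed.

Lemma is_RS_integral_unique f g a b v w : a < b ->
    {in `[a, b] &, {homo g : x y / x <= y}} ->
  is_RS_integral f g a b v -> is_RS_integral f g a b w -> v = w.
Proof.
move=> ab gh fv fw.
have H v' w' : is_RS_integral f g a b v' -> is_RS_integral f g a b w' ->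
  v' <= w'.
  move=> fv' fw'; rewrite -[w']mul1r -[leRHS]add0r.
  rewrite -[X in X + _](mul0r (g b - g a)).
  by apply: is_RS_integral_le_affine fv' fw' => // x _; rewrite add0r mul1r.
by apply/eqP; rewrite eq_le !H.
Qed.

Lemma RS_integralE f g a b v : a < b ->
    {in `[a, b] &, {homo g : x y / x <= y}} ->
  is_RS_integral f g a b v -> RS_integral f g a b = v.
Proof.
move=> ab gh fv; rewrite /RS_integral; case: xgetP => [w _ /= fw|/(_ v)//].
exact: is_RS_integral_unique fw fv.
Qed.

Lemma is_RS_integral_ge f g a b v c : a < b ->
    (forall s, itv_partition a b s -> c <= left_sum f g a s) ->
  is_RS_integral f g a b v -> c <= v.
Proof.
move=> ab cs fv; apply/ler_addgt0Pr => e e0.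
have [s [/cs]] := RS_integral_left_sums _ _ _ _ _ _ _ _ ab e0 fv fv.
by rewrite ltr_distl => ? /andP[_ ?] _; lra.
Qed.

(** For f nonincreasing and g nondecreasing this is the upper Darboux-Stieltjes integral, the
    explicit candidate for the value of the integral. *)
Definition upper_RS f g a b :=
  inf [set left_sum f g a s | s in itv_partition a b].

Lemma left_sum_cat f g a b s t : itv_partition a b s ->
  left_sum f g a (s ++ t) = left_sum f g a s + left_sum f g b t.
Proof.
elim: s a => [|x s IH] a.
  by move=> /itv_partition_nil ->; rewrite /left_sum RS_sum_nil add0r.
by move=> /itv_partition_consP[_ /IH E]; rewrite /= !left_sum_cons E addrA.
Qed.

(** * Upper integrals of monotone functions on subintervals of a fixed [[A, B]] *)

Section monotone.
Context {f g A B} (fB : {in `[A, B] &, {homo f : x y /~ x <= y}})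
  (gB : {in `[A, B] &, {homo g : x y / x <= y}}).

Lemma left_sum_ge a b s : A <= a -> b <= B -> itv_partition a b s ->
  f b * (g b - g a) <= left_sum f g a s.
Proof.
move=> Aa bB; elim: s a Aa => [|x s IH] a Aa.
  by move=> /itv_partition_nil ->; rewrite /left_sum RS_sum_nil subrr mulr0.
move=> /itv_partition_consP[ax xs]; have xb := itv_partition_le xs.
rewrite left_sum_cons; have := IH x (le_trans Aa (ltW ax)) xs.
have aAB : a \in `[A, B] by rewrite in_itv /= Aa /=; lra.
have xAB : x \in `[A, B] by rewrite in_itv /=; lra.
have bAB : b \in `[A, B] by rewrite in_itv /= bB andbT; lra.
have := gB _ _ aAB xAB (ltW ax); have := fB _ _ bAB aAB (le_trans (ltW ax) xb).
by nra.
Qed.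

Lemma has_inf_left_sum a b : A <= a -> a <= b -> b <= B ->
  has_inf [set left_sum f g a s | s in itv_partition a b].
Proof.
move=> Aa ab bB; split; last first.
  by exists (f b * (g b - g a)) => _ [s /= sP <-]; exact: left_sum_ge.
move: ab; rewrite le_eqVlt => /predU1P[<-|ab].
  by exists (left_sum f g a [::]), [::] => //=; split.
by exists (left_sum f g a [:: b]), [:: b] => //=; exact: itv_partition1.
Qed.

Lemma upper_RS_ge a b : A <= a -> a <= b -> b <= B ->
  f b * (g b - g a) <= upper_RS f g a b.
Proof.
move=> Aa ab bB; apply: lb_le_inf;
  first by case: (has_inf_left_sum _ _ Aa ab bB).
by move=> _ [s /= sP <-]; exact: left_sum_ge.
Qed.

Lemma upper_RS_le_left_sum a b s : A <= a -> b <= B -> itv_partition a b s ->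
  upper_RS f g a b <= left_sum f g a s.
Proof.
move=> Aa bB sP; apply: ge_inf; last by exists s.
by case: (has_inf_left_sum _ _ Aa (itv_partition_le sP) bB).
Qed.

Lemma upper_RSxx a : A <= a -> a <= B -> upper_RS f g a a = 0.
Proof.
move=> Aa aB; apply/eqP; rewrite eq_le.
have := upper_RS_ge _ _ Aa (lexx a) aB; rewrite subrr mulr0 => ->;
  rewrite andbT.
have aa : itv_partition a a [::] by [].
by have := upper_RS_le_left_sum _ _ _ Aa aB aa; rewrite /left_sum RS_sum_nil.
Qed.

Lemma upper_RS_le a b : A <= a -> a <= b -> b <= B ->
  upper_RS f g a b <= f a * (g b - g a).
Proof.
move=> Aa; rewrite le_eqVlt => /predU1P[<-|ab] bB.
  by rewrite upper_RSxx// subrr mulr0.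
have := upper_RS_le_left_sum _ _ _ Aa bB (itv_partition1 ab).
by rewrite left_sum_cons /left_sum RS_sum_nil addr0.
Qed.

(* Inserting the point b lowers a left sum, as f is nonincreasing. *)
Lemma left_sum_split a b c s : A <= a -> a < b -> b < c -> c <= B ->
    itv_partition a c s ->
  exists s1 s2, [/\ itv_partition a b s1, itv_partition b c s2 &
    left_sum f g a s1 + left_sum f g b s2 <= left_sum f g a s].
Proof.
move=> + + bc cB; elim: s a => [|x s IH] a Aa ab.
  by move=> /itv_partition_nil ac; lra.
move=> /itv_partition_consP[ax xs]; have xc := itv_partition_le xs.
have [bx|xb|bx] := ltgtP b x.
- exists [:: b], (x :: s); split; first exact: itv_partition1.
    by apply/itv_partition_consP.
  rewrite !left_sum_cons {1}/left_sum RS_sum_nil.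
  have aAB : a \in `[A, B] by rewrite in_itv /= Aa /=; lra.
  have xAB : x \in `[A, B] by rewrite in_itv /=; lra.
  have bAB : b \in `[A, B] by rewrite in_itv /=; lra.
  have := gB _ _ bAB xAB (ltW bx); have := fB _ _ bAB aAB (ltW ab).
  by nra.
- have [s1 [s2 [s1P s2P ss]]] := IH x (le_trans Aa (ltW ax)) xb xs.
  exists (x :: s1), s2; split=> //; first exact/itv_partition_consP.
  by rewrite !left_sum_cons; lra.
- exists [:: b], s; rewrite bx; split=> //; first exact: itv_partition1.
  by rewrite !left_sum_cons {1}/left_sum RS_sum_nil addr0.
Qed.

(** Splitting a partition at b gives one inequality; concatenating nearly optimal partitions of the
    two halves gives the other. *)
Lemma upper_RSD a b c : A <= a -> a <= b -> b <= c -> c <= B ->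
  upper_RS f g a c = upper_RS f g a b + upper_RS f g b c.
Proof.
move=> Aa; rewrite le_eqVlt => /predU1P[<- ac cB|ab].
  by rewrite upper_RSxx ?add0r// (le_trans ac).
rewrite le_eqVlt => /predU1P[<- bB|bc cB].
  by rewrite upper_RSxx ?addr0// (le_trans Aa (ltW ab)).
have Ab := le_trans Aa (ltW ab); have bB := le_trans (ltW bc) cB.
have ac := ltW (lt_trans ab bc).
apply/eqP; rewrite eq_le; apply/andP; split; last first.
  apply: lb_le_inf; first by case: (has_inf_left_sum _ _ Aa ac cB).
  move=> _ [s /= sP <-].
  have [s1 [s2 [s1P s2P ss]]] := left_sum_split _ _ _ _ Aa ab bc cB sP.
  by apply: le_trans ss; rewrite lerD// upper_RS_le_left_sum.
apply/ler_addgt0Pr => e e0; have e2 : 0 < e / 2 by lra.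
have [_ [s1 /= s1P <-] e1] :=
  inf_adherent e2 (has_inf_left_sum _ _ Aa (ltW ab) bB).
have [_ [s2 /= s2P <-] e2'] :=
  inf_adherent e2 (has_inf_left_sum _ _ Ab (ltW bc) cB).
have := upper_RS_le_left_sum _ _ _ Aa cB (itv_partition_cat s1P s2P).
rewrite (left_sum_cat _ _ _ _ _ _ s1P) /upper_RS in e1 e2' *.
by lra.
Qed.

(** On a cell from a to x, both the term of the sum and the upper integral lie between f x * (g x -
    g a) and f a * (g x - g a), so they differ by at most e * (f a - f x). These bounds
    telescope. *)
Lemma RS_sum_upper_RS a b s xi d e : A <= a -> b <= B -> itv_partition a b s ->
    is_tagging s xi a -> mesh_lt s a d ->
    {in `[A, B] &, forall x y, x <= y -> y - x < d -> g y - g x <= e} ->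
  `|RS_sum f g a s xi - upper_RS f g a b| <= e * (f a - f b).
Proof.
move=> + bB + + + ge; elim: s a xi => [|x s IH] a xi Aa.
  move=> /[dup] /itv_partition_le ab /itv_partition_nil E _ _.
  by rewrite RS_sum_nil -E upper_RSxx ?subrr ?mulr0 ?normr0// E.
move=> /itv_partition_consP[ax xs] /is_tagging_cons[xi0 tag].
move=> /mesh_lt_cons[xad mesh]; have xb := itv_partition_le xs.
have := IH _ _ (le_trans Aa (ltW ax)) xs tag mesh.
have Ax := le_trans Aa (ltW ax); have xB := le_trans xb bB.
rewrite RS_sum_cons (upper_RSD a x b) ?(ltW ax)//.
have := upper_RS_le _ _ Aa (ltW ax) xB; have := upper_RS_ge _ _ Aa (ltW ax) xB.
have aAB : a \in `[A, B] by rewrite in_itv /= Aa /=; lra.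
have xAB : x \in `[A, B] by rewrite in_itv /=; lra.
move: xi0; rewrite in_itv /= => /andP[axi xix].
have xiAB : xi 0%N \in `[A, B] by rewrite in_itv /=; lra.
have := ge _ _ aAB xAB (ltW ax) xad; have := gB _ _ aAB xAB (ltW ax).
have := fB _ _ xAB xiAB xix; have := fB _ _ xiAB aAB axi.
by rewrite !ler_distl => ? ? ? ? ? ? /andP[? ?]; apply/andP; split; nra.
Qed.

Lemma is_RS_integral_upper_RS a b : A <= a -> a <= b -> b <= B ->
    (forall e, 0 < e -> exists2 d, 0 < d &
      {in `[A, B] &, forall x y, x <= y -> y - x < d -> g y - g x <= e}) ->
  is_RS_integral f g a b (upper_RS f g a b).
Proof.
move=> Aa ab bB gc e e0.
(* Adding 1 keeps the divisor of e positive when f a = f b. *)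
have fab : 0 < f a - f b + 1.
  rewrite ltr_wpDl// subr_ge0 fB// in_itv /= ?Aa ?bB ?andbT; lra.
have [d d0 ge] := gc _ (divr_gt0 e0 fab); exists d => // s xi sP tag mesh.
apply: le_lt_trans (RS_sum_upper_RS _ _ _ _ _ _ Aa bB sP tag mesh ge) _.
by rewrite mulrAC -mulrA gtr_pMr// ltr_pdivrMr// mul1r ltrDl.
Qed.

End monotone.

End RiemannStieltjes.

(** * Concave distortion functions *)

Section Concave.
Context {R : realType}.
Implicit Types (f h : R -> R) (a b c d e m k t x y : R).
Context (Q : R -> R) (QB : BUM Q) (Qc : concave_on01 Q).

Lemma BUM0 : Q 0 = 0. Proof. by case: QB. Qed.
Lemma BUM1 : Q 1 = 1. Proof. by case: QB. Qed.
Lemma BUM_homo a : 0 <= a -> {in `[a, 1] &, {homo Q : x y / x <= y}}.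
Proof.
case: QB => _ _ _ H a0 x y; rewrite !in_itv /= => /andP[ax x1] /andP[ay y1].
by apply: H; rewrite in_itv /= ?(le_trans a0).
Qed.
Lemma BUM_ge0 x : 0 <= x -> x <= 1 -> 0 <= Q x.
Proof.
by move=> x0 x1; case: QB => /(_ x);
  rewrite !in_itv /= x0 x1 => /(_ isT)/andP[].
Qed.

Lemma concave_on01P t x y : 0 <= t -> t <= 1 -> 0 <= x -> x <= 1 -> 0 <= y ->
  y <= 1 ->
  t * Q x + (1 - t) * Q y <= Q (t * x + (1 - t) * y).
Proof.
move=> t0 t1 x0 x1 y0 y1.
have xE : x \in `[0, 1]%classic by rewrite inE /= in_itv /= x0.
have yE : y \in `[0, 1]%classic by rewrite inE /= in_itv /= y0.
(* The weight of a convex combination is an element of an interval type, so the bounds on t must be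
   packaged with it. *)
have t01 : Itv.spec (@Itv.num_sem R) (Itv.Real `[0%Z, 1%Z]) t.
  by rewrite /Itv.spec /= /Itv.num_sem /= num_real in_itv /= t0 t1.
have := Qc (Itv.Def t01) x y xE yE.
by rewrite !convRE /= /unstable.onem; lra.
Qed.

Lemma BUM_concave_ge_id t : 0 <= t -> t <= 1 -> t <= Q t.
Proof.
move=> t0 t1; have := concave_on01P t 1 0 t0 t1 ler01 (lexx 1) (lexx 0) ler01.
by rewrite BUM0 BUM1 !mulr0 !addr0 !mulr1.
Qed.

(** As Q 0 = 0, concavity on [0, y] puts Q above the chord from the origin. *)
Lemma concave_ratio x y : 0 <= x -> x <= y -> 0 < y -> y <= 1 ->
  x / y * Q y <= Q x.
Proof.
move=> x0 xy y0 y1; have y0' := ltW y0.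
have r0 : 0 <= x / y by rewrite divr_ge0.
have r1 : x / y <= 1 by rewrite ler_pdivrMr// mul1r.
have := concave_on01P (x / y) y 0 r0 r1 y0' y1 (lexx 0) ler01.
by rewrite BUM0 !mulr0 !addr0 divfK ?gt_eqF.
Qed.

(** The chord from the origin to y bounds the increment by (1 - x / y) * Q y, where Q y <= 1 and y
    >= a. *)
Lemma concave_lipschitz a x y : 0 < a -> a <= x -> x <= y -> y <= 1 ->
  Q y - Q x <= (y - x) / a.
Proof.
move=> a0 ax xy y1; have y0 : 0 < y by lra.
have H := concave_ratio x y (le_trans (ltW a0) ax) xy y0 y1.
have Qy1 : Q y <= 1.
  by case: QB => /(_ y); rewrite !in_itv /= y1 (ltW y0) => /(_ isT)/andP[].
have E : x / y = 1 - (y - x) / y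
  by rewrite mulrBl divff ?gt_eqF// opprB addrC subrK.
have : (y - x) / y <= (y - x) / a.
  by rewrite ler_wpM2l ?subr_ge0// lef_pV2 ?posrE// (le_trans ax).
have : 0 <= (y - x) / y by rewrite divr_ge0 ?subr_ge0// ltW.
have := BUM_ge0 y (ltW y0) y1.
by rewrite E in H; nra.
Qed.

(** Subadditivity: the chord bounds at x and at y - x add up to Q y. *)
Lemma concave_modulus x y : 0 <= x -> x <= y -> y <= 1 ->
  Q y - Q x <= Q (y - x).
Proof.
move=> x0 xy y1; have [y0|y0] := ltP 0 y; last first.
  by have -> : y = 0 by [lra]; have -> : x = 0 by [lra];
    rewrite subr0 BUM0 subrr.
have H1 := concave_ratio x y x0 xy y0 y1.
have H2 : (y - x) / y * Q y <= Q (y - x) by apply: concave_ratio; lra.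
have E : (y - x) / y = 1 - x / y by rewrite mulrBl divff ?gt_eqF.
by rewrite E in H2; lra.
Qed.

(** Since Q 0 = 0, this is right continuity of Q at 0. *)
Definition no_jump0 := forall e, 0 < e -> exists2 d, 0 < d &
  forall t, 0 <= t -> t <= 1 -> t < d -> Q t <= e.

Lemma no_jump0_uniform : no_jump0 -> forall e, 0 < e -> exists2 d, 0 < d &
  {in `[0, 1] &, forall x y, x <= y -> y - x < d -> Q y - Q x <= e}.
Proof.
move=> nj e /nj[d d0 H]; exists d => // x y; rewrite !in_itv /=.
move=> /andP[x0 x1] /andP[y0 y1] xy xyd.
by apply: le_trans (concave_modulus _ _ x0 xy y1) (H _ _ _ xyd); lra.
Qed.

(** Away from 0 uniform continuity holds even if Q jumps at 0. The truncated integrals therefore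
    exist before a jump has been excluded. *)
Lemma BUM_uniform a : 0 < a -> forall e, 0 < e -> exists2 d, 0 < d &
  {in `[a, 1] &, forall x y, x <= y -> y - x < d -> Q y - Q x <= e}.
Proof.
move=> a0 e e0; exists (e * a); first exact: mulr_gt0.
move=> x y; rewrite !in_itv /= => /andP[ax _] /andP[_ y1] xy xyd.
apply: le_trans (concave_lipschitz _ _ _ a0 ax xy y1) _.
by rewrite ler_pdivrMr// ltW.
Qed.

(** * Integrands that may be unbounded near 0 *)

Section improper.
Context h (h0 : {in `]0, 1], forall x, 0 <= h x})
  (hm : {in `]0, 1] &, {homo h : x y /~ x <= y}}).

Let sub a x : 0 < a -> x \in `[a, 1] -> x \in `]0, 1].
Proof. by rewrite !in_itv /= => a0 /andP[/(lt_le_trans a0)-> ->]. Qed.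

Let hma a : 0 < a -> {in `[a, 1] &, {homo h : x y /~ x <= y}}.
Proof. by move=> a0 x y /(sub _ _ a0) xE /(sub _ _ a0) yE; exact: hm. Qed.

Lemma is_RS_integral_away0 a b : 0 < a -> a <= b -> b <= 1 ->
  is_RS_integral h Q b 1 (upper_RS h Q b 1).
Proof.
move=> a0 ab b1; apply: (is_RS_integral_upper_RS (hma _ a0)
  (BUM_homo _ (ltW a0))) => //.
exact: BUM_uniform.
Qed.

Lemma RS_integral_away0E a : 0 < a -> a < 1 ->
  RS_integral h Q a 1 = upper_RS h Q a 1.
Proof.
move=> a0 a1; apply: RS_integralE => //; first exact/BUM_homo/ltW.
by apply: is_RS_integral_away0 (lexx a) (ltW a1).
Qed.

Lemma RS_integral_away0_ge0 a : 0 < a -> a < 1 -> 0 <= RS_integral h Q a 1.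
Proof.
move=> a0 a1; rewrite RS_integral_away0E//.
have := upper_RS_ge (hma _ a0) (BUM_homo _ (ltW a0)) _ _ (lexx a) (ltW a1)
  (lexx 1).
apply: le_trans; rewrite mulr_ge0 ?h0 ?in_itv /= ?ltr01 ?lexx//.
by rewrite subr_ge0 (BUM_homo _ (ltW a0)) ?in_itv /= ?lexx ?(ltW a1).
Qed.

Lemma RS_integral_away0_nonincreasing :
  {in `]0, 1[ &, {homo (fun a => RS_integral h Q a 1) : x y /~ x <= y}}.
Proof.
move=> y x; rewrite !in_itv /= => /andP[y0 y1] /andP[x0 x1] xy.
rewrite !RS_integral_away0E//.
have hx := hma _ x0; have Qx := BUM_homo _ (ltW x0).
rewrite (upper_RSD hx Qx x y 1) ?(ltW y1)// lerDr.
have := upper_RS_ge hx Qx _ _ (lexx x) xy (ltW y1).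
apply: le_trans; rewrite mulr_ge0 ?h0 ?in_itv /= ?y0 ?(ltW y1)//.
by rewrite subr_ge0 Qx ?in_itv /= ?lexx ?xy ?(ltW x1) ?(ltW y1).
Qed.

(** Both terms of the improper integral are nonnegative, so a finite value makes each finite. For
    the first term this means a zero jump; for the second, the truncated integrals grow as a
    decreases to 0 and are bounded by their supremum S. *)
Lemma improper_RS_finite c b : 0 < c ->
    b%:E = (c%:E * improper_RS_integral h Q)%E ->
  no_jump0 /\ forall a, 0 < a -> a < 1 -> c * RS_integral h Q a 1 <= b.
Proof.
move=> c0; rewrite /improper_RS_integral.
have cvgI : (RS_integral h Q a 1)%:E @[a --> 0^'+] -->
    ereal_sup ((fun a => (RS_integral h Q a 1)%:E) @` `]0, 1[).
  apply: (nonincreasing_at_right_cvge (BLeft 1)); first by rewrite bnd_simp.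
  by move=> x y xE yE xy; rewrite lee_fin;
    exact: RS_integral_away0_nonincreasing.
rewrite (cvg_lim _ cvgI)//; set S := ereal_sup _.
have S_ge a : 0 < a -> a < 1 -> ((RS_integral h Q a 1)%:E <= S)%E.
  by move=> a0 a1; apply: ereal_sup_ubound; exists a => //=;
    rewrite in_itv /= a0.
have S0 : (0 <= S)%E.
  by apply: le_trans (S_ge 2^-1 _ _);
    rewrite ?lee_fin ?RS_integral_away0_ge0//; lra.
have lb0 : has_lbound (Q @` `]0, 1]).
  exists 0 => _ [x /= + <-]; rewrite in_itv /= => /andP[x0 x1].
  by rewrite BUM_ge0// ltW.
have cvgQ : Q t @[t --> 0^'+] --> inf (Q @` `]0, 1]).
  apply: (@nondecreasing_at_right_cvgr _ Q 0 (BRight 1)) => //.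
    by rewrite bnd_simp.
  move=> x y /[!in_itv] /= /andP[x0 x1] /andP[y0 y1].
  by apply: (BUM_homo _ (lexx 0)); rewrite in_itv /= ?(ltW x0) ?(ltW y0).
rewrite (cvg_lim _ cvgQ)//; set L := inf _; rewrite BUM0 subr0 => bE.
have L0 : 0 <= L.
  apply: lb_le_inf; first by exists (Q 1), 1 => //=;
    rewrite in_itv /= ltr01 lexx.
  by move=> _ [x /= + <-]; rewrite in_itv /= => /andP[x0 x1];
    rewrite BUM_ge0// ltW.
(* L is the jump of Q at 0; if it were positive, the right-hand side of bE would be +oo. *)
have L00 : L = 0.
  apply/eqP; rewrite eq_le L0 andbT leNgt; apply/negP => Lpos.
  move: bE; rewrite gt0_mulye ?lte_fin// addye; last by rewrite gt_eqF//;
    exact: lt_le_trans (ltNyr 0) S0.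
  by rewrite gt0_muley ?lte_fin.
split=> [e e0|a a0 a1].
  have hi : has_inf (Q @` `]0, 1]).
    by split=> //; exists (Q 1), 1 => //=; rewrite in_itv /= ltr01 lexx.
  have [_ [x /= + <-]] := inf_adherent e0 hi.
  rewrite -/L L00 add0r in_itv /= => /andP[x0 x1] Qe; exists x => // t t0 t1 tx.
  apply: le_trans (ltW Qe); apply: (BUM_homo _ (lexx 0)); last exact: ltW.
    by rewrite in_itv /= t0.
  by rewrite in_itv /= x1 ltW.
rewrite -lee_fin bE L00 mule0 add0e EFinM lee_wpmul2l ?S_ge//.
by rewrite lee_fin (ltW c0).
Qed.

(** Unlike h, f is bounded at 0. The affine bound is applied on [a, 1] only, and the integral over
    [0, a] is at most f 0 * Q a, which is small with a. *)
Lemma RS_integral_le_improper f c b m k : 0 < c -> 0 <= m -> 0 <= k ->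
    b%:E = (c%:E * improper_RS_integral h Q)%E ->
    {in `[0, 1] &, {homo f : x y /~ x <= y}} ->
    {in `]0, 1[, forall t, f t <= m + k * (c * h t)} ->
  RS_integral f Q 0 1 <= m + k * b.
Proof.
move=> c0 m0 k0 bE fm fh; have [nj Ib] := improper_RS_finite _ _ c0 bE.
have Qm := BUM_homo _ (lexx 0).
have fI a : 0 <= a -> a <= 1 -> is_RS_integral f Q a 1 (upper_RS f Q a 1).
  by move=> a0 a1; exact: (is_RS_integral_upper_RS fm Qm _ _ _ _ _
    (no_jump0_uniform nj)).
rewrite (RS_integralE _ _ _ _ _ ltr01 Qm (fI _ (lexx 0) ler01)).
apply/ler_addgt0Pr => e e0.
have f0 : 0 < `|f 0| + 1 by rewrite ltr_wpDl.
have [d d0 Qd] := nj _ (divr_gt0 e0 f0).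
pose a := Num.min (d / 2) (1 / 2).
have a0 : 0 < a by rewrite lt_min; apply/andP; split; lra.
have ad : a < d by rewrite gt_min; apply/orP; left; lra.
have a1 : a < 1 by rewrite gt_min; apply/orP; right; lra.
rewrite (upper_RSD fm Qm 0 a 1) ?(ltW a0) ?(ltW a1)//.
have I0 := upper_RS_le fm Qm 0 a (lexx 0) (ltW a0) (ltW a1).
have Ia : upper_RS f Q a 1 <= m * (Q 1 - Q a) + k * c * RS_integral h Q a 1.
  rewrite RS_integral_away0E//.
  apply: (is_RS_integral_le_affine f Q h a 1) => //;
    rewrite ?mulr_ge0 ?(ltW c0)//.
  - by apply: BUM_homo; exact: ltW.
  - move=> x; rewrite in_itv /= -mulrA => /andP[ax x1]; apply: fh.
    by rewrite in_itv /= x1 (lt_le_trans a0).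
  - by apply: fI; exact: ltW.
  - by apply: is_RS_integral_away0 (lexx a) (ltW a1).
have := Qd a (ltW a0) (ltW a1) ad; rewrite ler_pdivlMr// => Qae.
have := BUM_ge0 a (ltW a0) (ltW a1).
have := ler_wpM2l k0 (Ib a a0 a1); have := ler_norm (f 0).
move: Ia I0; rewrite BUM0 BUM1 subr0.
by nra.
Qed.

Lemma improper_RS_bound_ge0 c b : 0 < c ->
  b%:E = (c%:E * improper_RS_integral h Q)%E -> 0 <= b.
Proof.
move=> c0 bE; have [_ Ib] := improper_RS_finite _ _ c0 bE.
have h2 : (2^-1 : R) < 1 by lra.
have h20 : 0 < (2^-1 : R) by lra.
by apply: le_trans (Ib _ h20 h2);
  rewrite mulr_ge0 ?(ltW c0)// RS_integral_away0_ge0.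
Qed.

End improper.
End Concave.

(** * Exponential inequalities *)

Section Calculus.
Context {R : realType}.
Implicit Types (f F : R -> R) (a b s t u x y : R).

Lemma is_derive_continuous f F : (forall x, is_derive x 1 F (f x)) ->
  continuous F.
Proof.
by move=> dF x; apply/differentiable_continuous/derivable1_diffP; case: (dF x).
Qed.

Lemma is_derive_ge0_le f F a b : (forall x, is_derive x 1 F (f x)) -> a <= b ->
  (forall x, a < x -> 0 <= f x) -> F a <= F b.
Proof.
move=> dF ab f0; apply: (@ger0_derive1_ndecry _ F a) => //.
- by move=> x; rewrite in_itv /= andbT => /f0; rewrite derive1E derive_val.
- apply: continuous_subspaceT; exact: is_derive_continuous dF.
Qed.

Lemma integral_is_derive f F a b : a < b -> (forall x, is_derive x 1 F (f x)) ->
    continuous f ->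
  (\int[lebesgue_measure]_(x in `[a, b]) (f x)%:E = (F b - F a)%:E)%E.
Proof.
move=> ab dF cf; have cF := is_derive_continuous _ _ dF.
rewrite EFinB; apply: continuous_FTC2 => //.
- exact: continuous_subspaceT.
- split=> //; first exact/cvg_at_right_filter/cF.
  exact/cvg_at_left_filter/cF.
- by move=> x _; rewrite derive1E derive_val.
Qed.

Lemma is_derive_expR_comp f x df :
  is_derive x 1 f df -> is_derive x 1 (fun y => expR (f y)) (expR (f x) * df).
Proof. by move=> ?; apply: is_derive1_comp. Qed.

(** The function equals 1 at 0, and in its derivative all terms of the polynomial factor cancel
    except x ^+ 3 / 9. *)
Lemma expR_quadratic_ge1 u : 0 <= u ->
  1 <= (1 + u + u ^+ 2 / 3) * expR (u ^+ 2 / 6 - u).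
Proof.
move=> u0.
pose F x := (1 + x + x ^+ 2 / 3) * expR (x ^+ 2 / 6 - x).
have dF x : is_derive x 1 F (x ^+ 3 / 9 * expR (x ^+ 2 / 6 - x)).
  have dE := @is_derive_expR_comp (fun y : R => y ^+ 2 / 6 - y) x _ _.
  rewrite /F; apply: is_derive_eq.
  by rewrite /GRing.scale /=; field.
have := is_derive_ge0_le _ _ _ _ dF u0.
rewrite {1}/F expr0n /= !mul0r !addr0 subr0 expR0 mulr1; apply.
by move=> x x0; rewrite mulr_ge0 ?expR_ge0// divr_ge0// exprn_ge0// ltW.
Qed.

Lemma expR_sub_expRN_le u : 0 <= u ->
  expR u - expR (- u) <= 2 * u * expR (u ^+ 2 / 6).
Proof.
move=> u0.
(* Multiplying by exp u turns the claim into monotonicity of F, whose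
   derivative is nonnegative by expR_quadratic_ge1. *)
pose F x := 2 * x * expR (x ^+ 2 / 6 + x) - expR (2 * x).
have dF x : is_derive x 1 F
   ((2 + 2 * x + 2 * (x ^+ 2) / 3) * expR (x ^+ 2 / 6 + x) - 2 * expR (2 * x)).
  have dE := @is_derive_expR_comp (fun y : R => y ^+ 2 / 6 + y) x _ _.
  have dE' := @is_derive_expR_comp (fun y : R => 2 * y) x _ _.
  rewrite /F; apply: is_derive_eq.
  by rewrite /GRing.scale /=; field.
have : F 0 <= F u.
  apply: is_derive_ge0_le dF u0 _ => x x0; rewrite subr_ge0.
  have -> : x ^+ 2 / 6 + x = (x ^+ 2 / 6 - x) + 2 * x by ring.
  rewrite expRD; have := expR_quadratic_ge1 x (ltW x0).
  by rewrite -subr_ge0 => /(mulr_ge0 (expR_ge0 (2 * x))); nra.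
rewrite /F !mulr0 mul0r expR0 sub0r expRD.
have -> : 2 * u = u + u by ring.
rewrite expRD; have := expRxMexpNx_1 u; have := expR_gt0 (- u).
set A := expR u; set B := expR (- u); set E := expR _.
(* Multiplying by B = exp (- u), the inverse of A, turns F 0 <= F u back into the claim. *)
move=> B0 AB1; rewrite lerBrDl -subr_ge0 => /(mulr_ge0 (ltW B0)) H.
rewrite -subr_ge0; apply: le_trans H _; rewrite le_eqVlt; apply/orP; left.
have BA : B * A = 1 by rewrite mulrC.
apply/eqP; transitivity ((u + u) * E * (B * A) - A * (B * A) + B);
  first by ring.
by rewrite BA; ring.
Qed.

Lemma integral_expRM s a b : a < b -> s != 0 ->
  (\int[lebesgue_measure]_(x in `[a, b]) (expR (s * x))%:E =
   ((expR (s * b) - expR (s * a)) / s)%:E)%E.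
Proof.
move=> ab s0; rewrite mulrBl.
apply: (@integral_is_derive (fun x => expR (s * x))
  (fun x => expR (s * x) / s)) => //.
  move=> x; have dE := @is_derive_expR_comp (fun y : R => s * y) x _ _.
  by apply: is_derive_eq; rewrite /GRing.scale /=; field.
apply: (@is_derive_continuous (fun x => s * expR (s * x))) => x.
have dE := @is_derive_expR_comp (fun y : R => s * y) x _ _.
by apply: is_derive_eq; rewrite /GRing.scale /=; ring.
Qed.

Lemma integral_id a b : a < b ->
  (\int[lebesgue_measure]_(x in `[a, b]) x%:E = ((b ^+ 2 - a ^+ 2) / 2)%:E)%E.
Proof.
move=> ab; rewrite mulrBl.
apply: (@integral_is_derive id (fun x => x ^+ 2 / 2)) => //.
  by move=> x; apply: is_derive_eq; rewrite /GRing.scale /=; field.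
by move=> x; exact: cvg_id.
Qed.

(** The left side is the moment generating function of the uniform law. Centred at the midpoint,
    with u = s * (b - a) / 2, it becomes a multiple of sinh u / u. A variance proxy (b - a) ^+ 2 /
    12 gives the 24 in the exponent. *)
Lemma uniform_mgf_le s a b : a < b -> 0 < s ->
  (b - a)^-1 * ((expR (s * b) - expR (s * a)) / s) <=
  expR (s * ((a + b) / 2) + s ^+ 2 * (b - a) ^+ 2 / 24).
Proof.
move=> ab s0; have d0 : 0 < b - a by rewrite subr_gt0.
pose u := s * (b - a) / 2; have u0 : 0 < u by rewrite divr_gt0 ?mulr_gt0.
have -> : s * b = s * ((a + b) / 2) + u by rewrite /u; field.
have -> : s * a = s * ((a + b) / 2) - u by rewrite /u; field.
have -> : s ^+ 2 * (b - a) ^+ 2 / 24 = u ^+ 2 / 6 by rewrite /u; field.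
rewrite !expRD -mulrBr; set M := expR _; set D := expR u - _.
have -> : (b - a)^-1 * (M * D / s) = M * (D / (2 * u)).
  by rewrite /u; field; rewrite !gt_eqF.
rewrite ler_pM2l ?expR_gt0// ler_pdivrMr ?mulr_gt0// mulrC.
exact/expR_sub_expRN_le/ltW.
Qed.

End Calculus.

(** * Products of independent variables *)

Section Independence.
Context {R : realType} {d : measure_display} {T : measurableType d}
  {P : probability T R}.
Import HBNNSimple.
Implicit Types (A : set R) (W : T -> R) (X : {RV P >-> R}) (phi : R -> R).

(** The factorisation, assumed for indicators of X, extends by linearity to simple functions and by
    monotone convergence to nonnegative measurable phi. *)
Lemma integral_mul_comp X W phi :
    measurable_fun setT W -> (forall w, 0 <= W w) ->
    (\int[P]_w (W w)%:E < +oo)%E ->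
    (forall A, measurable A -> (\int[P]_w (W w * \1_A (X w))%:E =
       \int[P]_w (W w)%:E * P (X @^-1` A))%E) ->
    measurable_fun setT phi -> (forall y, 0 <= phi y) ->
  (\int[P]_w (W w * phi (X w))%:E =
   \int[P]_w (W w)%:E * \int[P]_w (phi (X w))%:E)%E.
Proof.
move=> mW W0 Woo WA mphi phi0.
have mX : measurable_fun setT (X : T -> R) by [].
have IW0 : (0 <= \int[P]_w (W w)%:E)%E.
  by apply: integral_ge0 => w _; rewrite lee_fin.
have IWfin : (\int[P]_w (W w)%:E)%E \is a fin_num by rewrite ge0_fin_numE.
have simple (f : {nnsfun R >-> R}) :
    (\int[P]_w (W w * f (X w))%:E =
     \int[P]_w (W w)%:E * \int[P]_w (f (X w))%:E)%E.
  have mI r : measurable_fun setT (fun w => \1_(f @^-1` [set r]) (X w) : R).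
    apply: (measurableT_comp _ mX).
    apply: measurable_indic.
    by apply: measurable_funPTI.
  have rI r w : 0 <= r * \1_(f @^-1` [set r]) (X w).
    by have := nnfun_muleindic_ge0 f r (X w); rewrite lee_fin.
  have E1 w : (W w * f (X w))%:E =
      (\sum_(r \in range f) (W w * (r * \1_(f @^-1` [set r]) (X w)))%:E)%E.
    by rewrite fimfunE mulr_fsumr fsumEFin.
  have E2 w : (f (X w))%:E =
      (\sum_(r \in range f) (r * \1_(f @^-1` [set r]) (X w))%:E)%E.
    by rewrite {1}fimfunE fsumEFin.
  under eq_integral do rewrite E1.
  under [X in (_ * X)%E]eq_integral do rewrite E2.
  rewrite !ge0_integral_fsum//; last 4 first.
  - by move=> r; apply/measurable_EFinP; apply: measurable_funM.
  - by move=> r w _; rewrite lee_fin.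
  - move=> r; apply/measurable_EFinP; apply: measurable_funM => //.
    exact: measurable_funM.
  - by move=> r w _; rewrite lee_fin mulr_ge0.
  rewrite ge0_mule_fsumr; last first.
    by move=> r; apply: integral_ge0 => w _; rewrite lee_fin.
  apply: eq_fsbigr => r _.
  (* A negative r is not a value of f, so its fibre is empty; for other r the factor r leaves the
     integrals as a nonnegative constant. *)
  have [r0|r0] := ltP r 0.
    have E w : \1_(f @^-1` [set r]) (X w) = 0 :> R.
      by rewrite preimage_nnfun0// indic0.
    have -> : (\int[P]_w (W w * (r * \1_(f @^-1` [set r]) (X w)))%:E = 0)%E.
      by apply: integral0_eq => w _; rewrite E !mulr0.
    have -> : (\int[P]_w (r * \1_(f @^-1` [set r]) (X w))%:E = 0)%E.
      by apply: integral0_eq => w _; rewrite E mulr0.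
    by rewrite mule0.
  have -> : (\int[P]_w (W w * (r * \1_(f @^-1` [set r]) (X w)))%:E =
             r%:E * \int[P]_w (W w * \1_(f @^-1` [set r]) (X w))%:E)%E.
    rewrite -ge0_integralZl//.
    - by apply: eq_integral => w _; rewrite -EFinM mulrCA.
    - by apply/measurable_EFinP/measurable_funM.
    - by move=> w _; rewrite lee_fin mulr_ge0.
  have -> : (\int[P]_w (r * \1_(f @^-1` [set r]) (X w))%:E =
             r%:E * \int[P]_w (\1_(f @^-1` [set r]) (X w))%:E)%E.
    by rewrite -ge0_integralZl//; exact/measurable_EFinP.
  have mA : measurable (f @^-1` [set r]) by exact: measurable_funPTI.
  rewrite (WA _ mA) muleCA; congr (_ * (_ * _))%E.
  have -> : (\int[P]_w (\1_(f @^-1` [set r]) (X w))%:E =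
            \int[P]_w (\1_(X @^-1` (f @^-1` [set r])) w)%:E)%E by [].
  by rewrite integral_indic ?setIT//; exact: measurable_funPTI.
have mphi' : measurable_fun [set: R] (EFin \o phi).
  exact/measurable_EFinP.
have phi0' y : [set: R] y -> (0 <= (EFin \o phi) y)%E.
  by move=> _; rewrite lee_fin.
pose f_ := nnsfun_approx measurableT mphi'.
have f_cvg y : (f_ n y)%:E @[n --> \oo] --> (phi y)%:E.
  exact: (cvg_nnsfun_approx measurableT mphi' phi0').
have f_nd y : {homo (fun n => f_ n y) : m n / (m <= n)%N >-> m <= n}.
  by move=> m n mn; exact/lefP/nd_nnsfun_approx.
have mf n : measurable_fun setT (fun w => f_ n (X w))
  by exact: measurableT_comp.
transitivity (lim (\int[P]_w (W w * f_ n (X w))%:E @[n --> \oo])%E).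
  rewrite -monotone_convergence//=.
  - apply: eq_integral => w _; apply/esym/cvg_lim => //.
    under eq_fun do rewrite EFinM.
    by rewrite EFinM; apply: cvgeZl.
  - by move=> n; apply/measurable_EFinP/measurable_funM.
  - by move=> n w _; rewrite lee_fin mulr_ge0.
  - by move=> w _ m n mn; rewrite lee_fin ler_wpM2l// f_nd.
have -> : (\int[P]_w (phi (X w))%:E =
    lim (\int[P]_w (f_ n (X w))%:E @[n --> \oo]))%E.
  rewrite -monotone_convergence//=.
  - by apply: eq_integral => w _; apply/esym/cvg_lim.
  - by move=> n; exact/measurable_EFinP.
  - by move=> n w _; rewrite lee_fin.
  - by move=> w _ m n mn; rewrite lee_fin f_nd.
rewrite -limeMl//.
  by apply: congr_lim; apply/funext => n /=; exact: simple.
apply/ereal_nondecreasing_is_cvgn => m n mn; apply: ge0_le_integral => //=.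
- by move=> w _; rewrite lee_fin.
- exact/measurable_EFinP.
- exact/measurable_EFinP.
- by move=> w _; rewrite lee_fin f_nd.
Qed.


Lemma prod_indic n (A : 'I_n -> set R) (C : 'I_n -> {RV P >-> R}) w :
  \prod_j \1_(A j) (C j w) =
  \1_(\bigcap_(j in [set` finset.setT]) C j @^-1` A j) w :> R.
Proof.
rewrite [RHS]indicE; have [wA|wA] := boolP (w \in _).
  rewrite big1// => j _; rewrite indicE mem_set//.
  by move: wA; rewrite inE => /(_ j); apply; rewrite /= finset.in_setT.
have [j wj] : exists j, ~ A j (C j w).
  apply/existsNP => H; move/negP: wA; apply; rewrite inE => j _; exact: H.
by rewrite (bigD1 j)//= indicE memNset// mul0r.
Qed.

(** Independence concerns events, so one starts from a product of indicators and replaces them by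
    the phi j one index at a time. The list r holds the indices already treated; the claim is kept
    for all A because the step varies the event at the next index. *)
Lemma integral_prod_independent n (C : 'I_n -> {RV P >-> R})
    (phi : 'I_n -> R -> R) (c : 'I_n -> R) :
    mutually_independent C ->
    (forall j, measurable_fun setT (phi j)) -> (forall j y, 0 <= phi j y) ->
    (forall j, \int[P]_w (phi j (C j w))%:E = (c j)%:E)%E ->
  (\int[P]_w (\prod_j phi j (C j w))%:E = (\prod_j c j)%:E)%E.
Proof.
move=> indep mphi phi0 cE.
pose F (r : seq 'I_n) (A : 'I_n -> set R) j : R -> R :=
  if j \in r then phi j else \1_(A j).
pose I (r : seq 'I_n) (A : 'I_n -> set R) j : R :=
  if j \in r then c j else fine (P (C j @^-1` A j)).
suff claim (r : seq 'I_n) (A : 'I_n -> set R) : (forall j, measurable (A j)) ->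
    (\int[P]_w (\prod_j F r A j (C j w))%:E = (\prod_j I r A j)%:E)%E.
  have := claim (enum 'I_n) (fun=> setT) (fun=> measurableT).
  have FE j w : F (enum 'I_n) (fun=> setT) j w = phi j w by rewrite /F mem_enum.
  have IE j : I (enum 'I_n) (fun=> setT) j = c j by rewrite /I mem_enum.
  rewrite (eq_bigr _ (fun j _ => IE j)) => <-.
  by apply: eq_integral => w _; congr EFin; apply: eq_bigr => j _; rewrite FE.
have mC j : measurable_fun setT (C j : T -> R) by [].
have F0 (r' : seq 'I_n) (A' : 'I_n -> set R) j y : 0 <= F r' A' j y.
  by rewrite /F; case: ifP.
have mF (r' : seq 'I_n) (A' : 'I_n -> set R) j :
    (forall j, measurable (A' j)) -> measurable_fun setT (fun w => F r' A' j (C j w)).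
  move=> mA'; apply: (measurableT_comp _ (mC j)); rewrite /F; by case: ifP.
elim: r A => [|k r IH] A mA.
  rewrite /F /I /=; under eq_integral do rewrite prod_indic.
  have mCA j : measurable (C j @^-1` A j) by exact: measurable_funPTI.
  rewrite integral_indic ?setIT//; last first.
    by apply: fin_bigcap_measurable => //; exact: finite_finset.
  rewrite -prodEFin; apply: etrans (indep finset.setT A mA) _;
    apply: eq_big => [j|j _]; first by rewrite finset.in_setT.
  by rewrite fineK ?fin_num_measure.
have [kr|kr] := boolP (k \in r).
  have FE j : F (k :: r) A j = F r A j.
    by rewrite /F in_cons; case: eqP => // ->; rewrite kr.
  have IE j : I (k :: r) A j = I r A j.
    by rewrite /I in_cons; case: eqP => // ->; rewrite kr.
  rewrite (eq_bigr _ (fun j _ => IE j)) -(IH _ mA).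
  by apply: eq_integral => w _; congr EFin; apply: eq_bigr => j _; rewrite FE.
pose W w := \prod_(j | j != k) F r A j (C j w).
pose IW := \prod_(j | j != k) I r A j.
have WB B : measurable B ->
    (\int[P]_w (W w * \1_B (C k w))%:E = IW%:E * P (C k @^-1` B))%E.
  (* With B put at place k, the induction hypothesis says that W and the event at k factorise. *)
  move=> mB; pose A' j := if j == k then B else A j.
  have mA' j : measurable (A' j) by rewrite /A'; case: ifP.
  have FE j : j != k -> F r A' j = F r A j by rewrite /F /A' => /negbTE ->.
  have IE j : j != k -> I r A' j = I r A j by rewrite /I /A' => /negbTE ->.
  have Fk : F r A' k = \1_B by rewrite /F /A' (negbTE kr) eqxx.
  have Ik : (I r A' k)%:E = P (C k @^-1` B).
    rewrite /I /A' (negbTE kr) eqxx fineK// fin_num_measure//.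
    exact: measurable_funPTI.
  have := IH A' mA'.
  rewrite [in RHS](bigD1 k)//= (eq_bigr _ IE) -/IW EFinM muleC Ik => <-.
  apply: eq_integral => w _; congr EFin.
  rewrite [in RHS](bigD1 k)//= Fk mulrC; congr (_ * _).
  by apply: eq_bigr => j jk; rewrite FE.
(* Taking B = setT gives the integral of W itself, in particular its finiteness. *)
have WE : (\int[P]_w (W w)%:E = IW%:E)%E.
  have := WB setT measurableT;
    rewrite preimage_setT probability_setT mule1 => <-.
  by apply: eq_integral => w _; rewrite indicT mulr1.
have := @integral_mul_comp (C k) W (phi k); rewrite WE => H.
have Fk : F (k :: r) A k = phi k by rewrite /F mem_head.
have Ik : I (k :: r) A k = c k by rewrite /I mem_head.
rewrite [in RHS](bigD1 k)//= mulrC EFinM Ik -cE.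
have -> : \prod_(j | j != k) I (k :: r) A j = IW.
  by apply: eq_bigr => j /negbTE jk; rewrite /I in_cons jk.
rewrite -H ?ltry//.
- apply: eq_integral => w _; congr EFin.
  rewrite (bigD1 k)//= Fk mulrC; congr (_ * _).
  by apply: eq_bigr => j /negbTE jk; rewrite /F in_cons jk.
- rewrite /W; under eq_fun do rewrite -big_filter.
  by apply: measurable_prod => j _; exact: mF.
- by move=> w; apply: prodr_ge0.
Qed.

End Independence.

(** * Uniform variables *)

Section Uniform.
Context {R : realType} {d : measure_display} {T : measurableType d}
  {P : probability T R}.
Implicit Types (a b s : R) (Y : {RV P >-> R}).

Lemma ae_bounded_integrable (f : T -> R) a b : measurable_fun setT f ->
  {ae P, forall w, a <= f w <= b} -> P.-integrable setT (EFin \o f).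
Proof.
move=> mf fab; apply/integrableP; split; first exact/measurable_EFinP.
apply: (@le_lt_trans _ _ (\int[P]_w (cst (`|a| + `|b|)%:E) w)%E); last first.
  by rewrite integral_cst//= probability_setT mule1 ltry.
apply: ae_ge0_le_integral => //.
- exact/measurableT_comp/measurable_EFinP.
- by move=> w _; rewrite lee_fin addr_ge0.
apply: filterS fab => w /andP[aw wb] _ /=; rewrite lee_fin ler_norml.
have := ler_norm (- a); have := ler_norm b; rewrite normrN.
by have := normr_ge0 a; have := normr_ge0 b; lra.
Qed.

(* [uniform_prob] lives on a copy of R with another display. *)
Let idR : measurableTypeR R -> R := idfun.

#[local] HB.instance Definition _ :=
  @isMeasurableFun.Build _ _ _ _ idR (@measurable_id _ _ setT).

Lemma integral_uniform_on Y a b (f : R -> R) : uniform_on a b Y ->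
    measurable_fun setT f -> (forall y, 0 <= f y) ->
  (a < b /\
    (\int[P]_w (f (Y w))%:E =
     (b - a)^-1%:E * \int[lebesgue_measure]_(y in `[a, b]) (f y)%:E)%E)
  \/ a = b /\ (\int[P]_w (f (Y w))%:E = (f a)%:E)%E.
Proof.
move=> YU mf f0; have mf' : measurable_fun [set: R] (EFin \o f).
  exact/measurable_EFinP.
have f0' y : (0 <= (EFin \o f) y)%E by rewrite lee_fin.
have E := ge0_integral_distribution Y mf' f0'.
case: YU => [[ab YU]|[ab YU]]; [left; split => //|right; split => //].
- rewrite -(integral_uniform ab mf' f0') -E.
  have <- := ge0_integral_distribution (idR : {RV uniform_prob ab >-> R}) mf'
    f0'.
  pose m1 : {measure set R -> \bar R} := distribution P Y.
  pose m2 : {measure set R -> \bar R} :=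
    distribution (uniform_prob ab) (idR : {RV uniform_prob ab >-> R}).
  apply: (@eq_measure_integral _ _ R setT m2 m1) => A mA _.
  exact: YU.
- have -> : (f a)%:E = (\int[\d_a]_y (EFin \o f) y)%E.
    by rewrite integral_dirac// diracT mul1e.
  by rewrite -E; apply: eq_measure_integral => A mA _; exact: YU.
Qed.

Lemma uniform_on_ae Y a b : uniform_on a b Y -> {ae P, forall w, a <= Y w <= b}.
Proof.
move=> YU; have : distribution P Y `[a, b] = 1%E.
  case: YU => [[ab ->//]|[-> ->//]].
    by rewrite /uniform_prob integral_uniform_pdf1.
  by rewrite diracE mem_set//= in_itv /= lexx.
move=> PY; exists (~` (Y @^-1` `[a, b])).
have mY : measurable (Y @^-1` `[a, b]) by exact: measurable_funPTI.
split; first exact: measurableC.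
  by rewrite probability_setC// [P _]PY subee.
by move=> w /= H H'; apply: H; move: H'; rewrite in_itv.
Qed.

Lemma uniform_on_le Y a b : uniform_on a b Y -> a <= b.
Proof. by case=> [[ab _]|[-> _]] //; exact: ltW. Qed.

Lemma uniform_on_integrable Y a b : uniform_on a b Y ->
  P.-integrable setT (EFin \o Y).
Proof. by move=> /uniform_on_ae; exact: ae_bounded_integrable. Qed.

Lemma uniform_on_expectation Y a b : 0 <= a -> uniform_on a b Y ->
  ('E_P[Y] = ((a + b) / 2)%:E)%E.
Proof.
move=> a0 YU; rewrite expectation_def.
(* The formula for the uniform law concerns nonnegative integrands; as a >= 0, Y equals its absolute
   value almost everywhere. *)
have -> : (\int[P]_w (Y w)%:E = \int[P]_w (`|Y w|)%:E)%E.
  apply: ae_eq_integral => //; first exact/measurable_EFinP.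
    by apply/measurable_EFinP; exact: measurableT_comp.
  apply: filterS (uniform_on_ae _ _ _ YU) => w /andP[aw _] _.
  by rewrite ger0_norm// (le_trans a0).
have [[ab ->]|[<- ->]] := integral_uniform_on Y a b Num.norm YU
    (@normr_measurable R setT) (@normr_ge0 _ _); last first.
  by rewrite ger0_norm//; congr EFin; field.
transitivity ((b - a)^-1%:E * \int[lebesgue_measure]_(y in `[a, b]) y%:E)%E.
  congr (_ * _)%E; apply: eq_integral => y.
  rewrite inE /= in_itv /= => /andP[ay _].
  by rewrite ger0_norm// (le_trans a0).
rewrite (integral_id a b ab) -EFinM; congr EFin; field.
by rewrite subr_eq0 gt_eqF.
Qed.

(** The witness c records that the integral is finite, as the product formula for independent
    variables takes real factors. *)
Lemma uniform_on_mgf Y a b s : 0 <= s -> uniform_on a b Y ->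
  exists2 c, (\int[P]_w (expR (s * Y w))%:E = c%:E)%E &
    0 <= c <= expR (s * ((a + b) / 2) + s ^+ 2 * (b - a) ^+ 2 / 24).
Proof.
move=> s0 YU.
have mf : measurable_fun setT (fun y : R => expR (s * y)).
  by apply: measurableT_comp => //; exact: measurable_funM.
have [[ab ->]|[<- ->]] := integral_uniform_on Y a b _ YU
    mf (fun y => expR_ge0 (s * y)); last first.
  exists (expR (s * a)) => //; rewrite expR_ge0 ler_expR /=.
  by rewrite le_eqVlt; apply/orP; left; apply/eqP; field.
(* The closed form divides by s; the value 0 occurs for zero components of the solution. *)
move: s0; rewrite le_eqVlt => /predU1P[<-|s0].
  exists 1; last by rewrite ler01 expr0n /= !mul0r addr0 expR0 /=.
  under eq_integral do rewrite mul0r expR0.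
  rewrite integral_cst//= lebesgue_measure_itv /= lte_fin ab mul1e -EFinB
    -EFinM.
  by rewrite mulVf// subr_eq0 gt_eqF.
rewrite integral_expRM ?gt_eqF// -EFinM; eexists; first by [].
rewrite uniform_mgf_le// andbT mulr_ge0 ?invr_ge0 ?subr_ge0 ?(ltW ab)//.
by rewrite divr_ge0 ?(ltW s0)// subr_ge0 ler_expR ler_pM2l// ltW.
Qed.

End Uniform.

(** * Value at risk *)

Section ValueAtRisk.
Context {R : realType} {d : measure_display} {T : measurableType d}
  {P : probability T R}.
Context {Y : {RV P >-> R}} {lo hi : R} (Yb : {ae P, forall w, lo <= Y w <= hi}).
Implicit Types (s t u v x y a : R).

Lemma measurable_RV_le y : measurable [set w | Y w <= y].
Proof.
have -> : [set w | Y w <= y] = Y @^-1` `]-oo, y].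
  by apply/seteqP; split=> w; rewrite /= in_itv.
exact: measurable_funPTI.
Qed.

Lemma measurable_RV_gt y : measurable [set w | y < Y w].
Proof.
have -> : [set w | y < Y w] = ~` [set w | Y w <= y].
  by apply/seteqP; split=> w /=; rewrite ltNge => /negP.
by apply: measurableC; exact: measurable_RV_le.
Qed.

Lemma cdfE y : cdf Y y = P [set w | Y w <= y].
Proof. by congr (P _); apply/seteqP; split=> w; rewrite /= in_itv. Qed.

Lemma probability_gt y : (P [set w | (y < Y w)%R] = 1 - cdf Y y)%E.
Proof.
rewrite cdfE -probability_setC; last exact: measurable_RV_le.
congr (P _).
by apply/seteqP; split=> w /=; rewrite ltNge => /negP.
Qed.

Let cdf_lt_lo y : y < lo -> cdf Y y = 0%E.
Proof.
move=> ylo; rewrite cdfE; apply: measure_negligible;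
  first exact: measurable_RV_le.
apply: negligibleS Yb => w /= wy /andP[low _].
by have := le_lt_trans wy ylo; rewrite ltNge low.
Qed.

Let cdf_hi : cdf Y hi = 1%E.
Proof.
have : P (~` [set w | Y w <= hi]) = 0%E.
  apply: measure_negligible.
    by apply: measurableC; exact: measurable_RV_le.
  by apply: negligibleS Yb => w /= whi /andP[_].
rewrite probability_setC -?cdfE => [/eqP|]; last exact: measurable_RV_le.
by rewrite sube_eq// ?add0e ?fin_num_measure// => /eqP <-.
Qed.

Definition quantile_set t :=
  if t == 0 then [set y | (0 < cdf Y y)%E] else [set y | (t%:E <= cdf Y y)%E].

Lemma VaRE t : VaR Y t = inf (quantile_set t).
Proof. by rewrite /VaR /quantile_set; case: ifP. Qed.

(** The set contains hi, and lo bounds it below since the distribution function vanishes before lo;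
    at t = 0 this relies on the strict inequality in the convention. *)
Lemma quantile_set_has_inf t : 0 <= t -> t <= 1 -> has_inf (quantile_set t).
Proof.
move=> t0 t1; rewrite /quantile_set; case: eqP => [_|/eqP tn0]; split.
- by exists hi; rewrite /= cdf_hi lte_fin.
- exists lo => y /= y0; rewrite leNgt; apply/negP => /cdf_lt_lo yE.
  by rewrite yE ltxx in y0.
- by exists hi; rewrite /= cdf_hi lee_fin.
- exists lo => y /= y0; rewrite leNgt; apply/negP => /cdf_lt_lo yE.
  by move: y0; rewrite yE lee_fin leNgt lt_neqAle eq_sym tn0 t0.
Qed.

Lemma VaR_homo : {in `[0, 1] &, {homo VaR Y : s t / s <= t}}.
Proof.
move=> s t; rewrite !in_itv /= => /andP[s0 s1] /andP[t0 t1] st; rewrite !VaRE.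
apply: lb_le_inf; first by case: (quantile_set_has_inf t t0 t1).
move=> y ty; apply: ge_inf; first by case: (quantile_set_has_inf s s0 s1).
move: ty; rewrite /quantile_set; have [t00|tn0] := eqVneq t 0.
  by have -> : s = 0 by [apply/eqP; rewrite eq_le s0 -t00 st]; rewrite eqxx.
case: eqP => _ /= ty; last by apply: le_trans ty; rewrite lee_fin.
by apply: lt_le_trans ty; rewrite lte_fin lt_neqAle eq_sym tn0.
Qed.

Lemma VaR_le t y : 0 < t -> t <= 1 -> (t%:E <= cdf Y y)%E -> VaR Y t <= y.
Proof.
move=> t0 t1 ty; rewrite VaRE; apply: ge_inf.
  by case: (quantile_set_has_inf t (ltW t0) t1).
by rewrite /quantile_set gt_eqF.
Qed.

(** By right continuity of the distribution function the infimum is attained. *)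
Lemma cdf_VaR_ge t : 0 < t -> t <= 1 -> (t%:E <= cdf Y (VaR Y t))%E.
Proof.
move=> t0 t1; have hi_t := quantile_set_has_inf t (ltW t0) t1.
have cr := @cdf_right_continuous _ _ _ P Y (VaR Y t).
apply: cvge_ge cr.
near=> y; have Vy : 0 < y - VaR Y t by rewrite subr_gt0; near: y;
  exact: nbhs_right_gt.
have [z] := inf_adherent Vy hi_t; rewrite -VaRE addrC subrK.
rewrite /quantile_set gt_eqF//= => tz zy.
by apply: le_trans tz _; apply: cdf_nondecreasing; exact: ltW.
Unshelve. all: by end_near.
Qed.

Lemma probability_gt_VaR t : 0 <= t -> t <= 1 ->
  (P [set w | (VaR Y (1 - t) < Y w)%R] <= t%:E)%E.
Proof.
move=> t0; rewrite le_eqVlt => /predU1P[->|t1].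
  by apply: probability_le1; exact: measurable_RV_gt.
have := cdf_VaR_ge (1 - t); rewrite subr_gt0 t1 gerBl t0 => /(_ isT isT).
rewrite probability_gt.
have : cdf Y (VaR Y (1 - t)) \is a fin_num by rewrite fin_num_measure.
case: (cdf Y _) => // r _; rewrite lee_fin -EFinB lee_fin; lra.
Qed.

Lemma ae_le_VaR1 : {ae P, forall w, Y w <= VaR Y 1}.
Proof.
have := probability_gt_VaR 0 (lexx 0) ler01;
  rewrite subr0 measure_le0 => /eqP P0.
exists [set w | (VaR Y 1 < Y w)%R]; split => //.
  exact: measurable_RV_gt.
by move=> w /= /negP; rewrite -ltNge.
Qed.

End ValueAtRisk.

(** * Lower bound for the distortion risk measure *)

Section Rho.
Context {R : realType} {d : measure_display} {T : measurableType d}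
  {P : probability T R}.
Context {Y : {RV P >-> R}} {lo hi : R} (Yb : {ae P, forall w, lo <= Y w <= hi}).
Context {Q : R -> R} (QB : BUM Q) (Qc : concave_on01 Q).
Implicit Types (t u v x y a k : R) (s : seq R).

Let f t := VaR Y (1 - t).

Lemma VaR_onem_homo : {in `[0, 1] &,
  {homo (fun t => VaR Y (1 - t)) : r t /~ r <= t}}.
Proof.
move=> r t /[!in_itv] /= /andP[r0 r1] /andP[t0 t1] rt.
by apply: (VaR_homo Yb); rewrite ?in_itv /= ?lerD2l ?lerN2 //; lra.
Qed.

Let mY : measurable_fun setT (Y : T -> R). Proof. by []. Qed.

Let min_integrable v : P.-integrable setT (EFin \o (fun w => Num.min (Y w) v)).
Proof.
apply: (ae_bounded_integrable _ (Num.min lo v) (Num.max hi v)).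
  exact: measurable_minr.
apply: filterS Yb => w /andP[low whi].
by rewrite le_min !ge_min !le_max low whi !lexx /= !orbT.
Qed.

Let psi v := (\int[P]_w (Num.min (Y w) v))%R.

Let psi_le v : psi v <= v.
Proof.
have ic : P.-integrable setT (EFin \o cst v)
  by exact: finite_measure_integrable_cst.
suff : psi v <= (\int[P]_w (cst v w))%R.
  by rewrite Rintegral_cst//= probability_setT mulr1.
by apply: le_Rintegral => // w _; rewrite /= ge_min lexx orbT.
Qed.

(** Pointwise, min(Y, u) <= min(Y, v) + (u - v) * 1_{Y > v}; then integrate. *)
Let psi_step u v q : v <= u -> (P [set w | (v < Y w)%R] <= q%:E)%E ->
  psi u <= psi v + (u - v) * q.
Proof.
move=> vu Pq; pose A := [set w | v < Y w].
have mA : measurable A by exact: measurable_RV_gt.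
have iA : P.-integrable setT (EFin \o (\1_A : T -> R)).
  exact: integrable_indic.
have iuA : P.-integrable setT (EFin \o (fun w => (u - v) * \1_A w)).
  rewrite (_ : _ \o _ =
    (fun w => (u - v)%:E * (EFin \o (\1_A : T -> R)) w)%E)//.
  exact: integrableZl.
have : psi u <= (\int[P]_w (Num.min (Y w) v + (u - v) * \1_A w))%R.
  apply: le_Rintegral => //.
    rewrite (_ : _ \o _ = (EFin \o (fun w => Num.min (Y w) v)) \+
      (EFin \o (fun w => (u - v) * \1_A w)))//.
    exact: integrableD.
  move=> w _; rewrite indicE; have [|wA] := boolP (w \in A).
    rewrite inE /A /= => vY; rewrite mulr1 (min_r (ltW vY)).
    by rewrite addrC subrK ge_min lexx orbT.
  have wv : Y w <= v.
    by rewrite leNgt; apply/negP => vY; move/negP: wA; rewrite inE.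
  by rewrite mulr0 addr0 (min_l wv) ge_min lexx.
move=> /le_trans; apply;
  rewrite RintegralD// lerD2l RintegralZl// ler_wpM2l ?subr_ge0//.
rewrite /Rintegral integral_indic// setIT -lee_fin fineK// fin_num_measure//.
Qed.

(** Summation by parts along the partition: on the cell from a to x, P(Y > f x) <= x <= Q x, so the
    increment of psi is at most (f a - f x) * Q x. The boundary term f a * Q a vanishes at a = 0. *)
Let psi_left_sum s a : 0 <= a -> itv_partition a 1 s ->
  psi (f a) <= f a * Q a + left_sum f Q a s.
Proof.
elim: s a => [|x s IH] a a0.
  move=> /itv_partition_nil ->.
  by rewrite /left_sum RS_sum_nil addr0 (BUM1 _ QB) mulr1 psi_le.
move=> /itv_partition_consP[ax xs]; have x1 := itv_partition_le xs.
have x0 := le_trans a0 (ltW ax).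
have fxa : f x <= f a.
  by apply: VaR_onem_homo;
    rewrite ?in_itv /= ?x0 ?x1 ?a0 ?ltW// (lt_le_trans ax).
have := IH x x0 xs.
have PQ : (P [set w | (f x < Y w)%R] <= (Q x)%:E)%E.
  apply: (le_trans (probability_gt_VaR Yb x x0 x1)).
  by rewrite lee_fin (BUM_concave_ge_id _ QB Qc).
have := psi_step _ _ _ fxa PQ.
by rewrite left_sum_cons; lra.
Qed.

Lemma rho_ge_expectation m : no_jump0 Q -> ('E_P[Y] = m%:E)%E -> m <= rho Q Y.
Proof.
move=> nj EY; have Q01 := BUM_homo _ QB 0 (lexx 0).
have fI := is_RS_integral_upper_RS VaR_onem_homo Q01 0 1 (lexx 0) ler01 (lexx 1)
  (no_jump0_uniform _ QB Qc nj).
rewrite /rho (RS_integralE _ _ _ _ _ ltr01 Q01 fI).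
apply: is_RS_integral_ge ltr01 _ fI => s sP.
have := psi_left_sum s 0 (lexx 0) sP; rewrite (BUM0 _ QB) mulr0 add0r;
  apply: le_trans.
rewrite -lee_fin -EY expectation_def /psi /Rintegral fineK; last first.
  exact: (integrable_fin_num measurableT (min_integrable (f 0))).
(* The level f 0 is VaR at 1, which bounds Y almost surely, so truncation there leaves the
   expectation unchanged. *)
rewrite le_eqVlt; apply/orP; left; apply/eqP.
apply: ae_eq_integral => //; first exact/measurable_EFinP.
  by apply/measurable_EFinP; exact: measurable_minr.
apply: filterS (ae_le_VaR1 Yb) => w wV _.
by rewrite /f subr0 min_l.
Qed.

End Rho.

(** * Sub-Gaussian tails *)

Section Subgaussian.
Context {R : realType} {d : measure_display} {T : measurableType d}
  {P : probability T R}.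
Context {Y : {RV P >-> R}} {lo hi : R} (Yb : {ae P, forall w, lo <= Y w <= hi}).
Context {m S : R} (S0 : 0 <= S).
Context (mgf : forall s : R, 0 < s ->
  ('M_P Y s <= (expR (s * m + s ^+ 2 * S / 24))%:E)%E).
Implicit Types s t : R.

Let VaR_chernoff s t : 0 < s -> 0 < t -> t < 1 ->
  VaR Y (1 - t) <= m + ln t^-1 / s + s * S / 24.
Proof.
(* This a makes the exponent in the Chernoff bound equal to - ln t^-1, so the tail beyond a has
   probability at most t. *)
move=> s0 t0 t1; set a := m + _ + _; have L0 : 0 < t^-1 by rewrite invr_gt0.
apply: (VaR_le Yb); rewrite ?subr_gt0 ?gerBl ?(ltW t0)//.
have : (P [set w | (a < Y w)%R] <= t%:E)%E.
  apply: (@le_trans _ _ (P [set w | (Y w >= a)%R])).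
    apply: le_measure; rewrite ?inE.
    - exact: measurable_RV_gt.
    - have -> : [set w | (a <= Y w)%R] = Y @^-1` `[a, +oo[.
        by apply/seteqP; split=> w; rewrite /= in_itv /= andbT.
      exact: measurable_funPTI.
    - by move=> w /= /ltW.
  apply: le_trans (chernoff Y a s0) _.
  apply: (@le_trans _ _ ((expR (s * m + s ^+ 2 * S / 24))%:E *
                         (expR (- (s * a)))%:E)%E).
    by apply: lee_wpmul2r; rewrite ?lee_fin ?expR_ge0// mgf.
  rewrite -EFinM lee_fin -expRD.
  have -> : s * m + s ^+ 2 * S / 24 - s * a = - ln t^-1.
    by rewrite /a; field; rewrite gt_eqF.
  by rewrite expRN lnK ?posrE// invrK.
rewrite probability_gt.
have : cdf Y a \is a fin_num by rewrite fin_num_measure.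
case: (cdf Y a) => // r _; rewrite -EFinB !lee_fin; lra.
Qed.

Lemma VaR_subgaussian t : 0 < t -> t < 1 ->
  VaR Y (1 - t) <= m + Num.sqrt (S * ln t^-1 / 6).
Proof.
move=> t0 t1; set L := ln t^-1.
have L0 : 0 < L by rewrite ln_gt0// invf_gt1.
have [S00|Sn0] := eqVneq S 0.
  (* For S = 0 no s is optimal; s = L / e gives m + e for every e > 0. *)
  rewrite S00 !mul0r sqrtr0 addr0; apply/ler_addgt0Pr => e e0.
  have := VaR_chernoff (L / e) t (divr_gt0 L0 e0) t0 t1;
    rewrite S00 mulr0 mul0r addr0.
  by rewrite -/L invf_div mulrCA divff ?gt_eqF// mulr1.
have Sp : 0 < S by rewrite lt_neqAle eq_sym Sn0.
set r := Num.sqrt _; have r0 : 0 < r by rewrite sqrtr_gt0 divr_gt0// mulr_gt0.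
have r2 : r ^+ 2 = S * L / 6 by rewrite sqr_sqrtr// divr_ge0// mulr_ge0// ltW.
(* This s minimises L / s + s * S / 24; both terms are then r / 2. *)
have := VaR_chernoff (2 * L / r) t (divr_gt0 (mulr_gt0 (ltr0Sn R 1) L0) r0)
  t0 t1.
rewrite -/L; congr (_ <= _).
have -> : m + L / (2 * L / r) + 2 * L / r * S / 24 =
    m + r / 2 + (S * L / 6) / (2 * r).
  by field; rewrite !gt_eqF.
by rewrite -r2; field; rewrite gt_eqF.
Qed.

(** exp (x / 2) is the square of exp (x / 4) >= 1 + x / 4, and (1 + x / 4) ^+ 2 - x = (1 - x / 4) ^+
    2 >= 0. *)
Lemma ln_le_half x : 0 < x -> ln x <= x / 2 :> R.
Proof.
move=> x0; rewrite -ler_expR lnK ?posrE//.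
have -> : x / 2 = x / 4 + x / 4 by field.
have := expR_ge1Dx (x / 4); rewrite expRD => H.
have : 0 <= (1 - x / 4) ^+ 2 by exact: sqr_ge0.
by nra.
Qed.

Lemma VaR_leV t : 0 < t -> t < 1 ->
  VaR Y (1 - t) <= m + Num.sqrt S * ((Num.sqrt 12)^-1 * Num.sqrt t^-1).
Proof.
move=> t0 t1; have tV0 : 0 < t^-1 by rewrite invr_gt0.
apply: le_trans (VaR_subgaussian t t0 t1) _; rewrite lerD2l.
rewrite -mulrA sqrtrM// ler_wpM2l ?sqrtr_ge0//.
rewrite -sqrtrV// -sqrtrM ?invr_ge0//; apply: ler_wsqrtr.
by have := ln_le_half _ tV0; lra.
Qed.

Lemma VaR_leH t : 0 < t -> t < 1 ->
  VaR Y (1 - t) <= m + Num.sqrt S * (Num.sqrt 2 / 2 * Num.sqrt (ln t^-1)).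
Proof.
move=> t0 t1; have L0 : 0 < ln t^-1 by rewrite ln_gt0// invf_gt1.
apply: le_trans (VaR_subgaussian t t0 t1) _; rewrite lerD2l.
rewrite -mulrA sqrtrM// ler_wpM2l ?sqrtr_ge0//.
have -> : Num.sqrt 2 / 2 = Num.sqrt (1 / 2) :> R.
  have -> : 1 / 2 = 2 / 2 ^+ 2 :> R by field.
  by rewrite sqrtrM// sqrtrV ?sqrtr_sqr ?ger0_norm// exprn_ge0.
rewrite -sqrtrM//; apply: ler_wsqrtr; lra.
Qed.

End Subgaussian.

(** * Linear costs *)

Section LinearCost.
Context {R : realType} {d : measure_display} {T : measurableType d}
  {P : probability T R}.
Context {n : nat} {C : 'I_n -> {RV P >-> R}} {lo hi : 'I_n -> R}.
Context (Cu : forall j, uniform_on (lo j) (hi j) (C j))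
  (lo0 : forall j, 0 <= lo j).
Context {x : 'rV[R]_n} (x0 : forall j, 0 <= x ord0 j).

Lemma linear_costE (y : 'rV[R]_n) w :
  linear_cost C y w = \sum_j y ord0 j * C j w.
Proof.
by rewrite /linear_cost mfun_sum; apply: eq_bigr => j _; rewrite /= mulrC.
Qed.

Lemma linear_cost_ae_bounded :
  {ae P, forall w, \sum_j x ord0 j * lo j <= linear_cost C x w
                   <= \sum_j x ord0 j * hi j}.
Proof.
have : {ae P, forall w, forall j, lo j <= C j w <= hi j}.
  by apply: filter_forall => j; exact: uniform_on_ae.
apply: filterS => w H; rewrite linear_costE.
by apply/andP; split; apply: ler_sum => j _; rewrite ler_wpM2l//;
  case/andP: (H j).
Qed.

Definition mean_cost : R := \sum_j (lo j + hi j) / 2 * x ord0 j.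
(** Twelve times the variance of the cost when the coefficients are independent. *)
Definition range_sqr : R := \sum_j (hi j - lo j) ^+ 2 * x ord0 j ^+ 2.

Lemma linear_cost_expectation : ('E_P[linear_cost C x] = mean_cost%:E)%E.
Proof.
rewrite expectation_def.
under eq_integral do rewrite linear_costE -sumEFin.
have iC j : P.-integrable setT (fun w => (x ord0 j)%:E * (EFin \o C j) w)%E.
  by apply: integrableZl => //; exact: uniform_on_integrable (Cu j).
rewrite (@integral_sum _ _ _ P setT measurableT 'I_n
  (fun j w => (x ord0 j)%:E * (EFin \o C j) w)%E iC).
rewrite -sumEFin; apply: eq_bigr => j _.
rewrite integralZl//; last exact: uniform_on_integrable (Cu j).
by rewrite -expectation_def (uniform_on_expectation _ _ _ (lo0 j)
  (Cu j)) -EFinM mulrC.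
Qed.

(** The exponential of the sum is a product of independent factors, the j-th being the uniform one
    at parameter s * x ord0 j; the exponents of their bounds add up. *)
Lemma linear_cost_mgf s : mutually_independent C -> 0 < s ->
  ('M_P (linear_cost C x) s <=
   (expR (s * mean_cost + s ^+ 2 * range_sqr / 24))%:E)%E.
Proof.
move=> indep s0.
have sx j : 0 <= s * x ord0 j by rewrite mulr_ge0 ?(ltW s0).
pose c j := fine (\int[P]_w (expR (s * x ord0 j * C j w))%:E)%E.
have cE j : (\int[P]_w (expR (s * x ord0 j * C j w))%:E = (c j)%:E)%E.
  by rewrite /c; have [r -> _] := uniform_on_mgf _ _ _ _ (sx j) (Cu j).
have c_le j : 0 <= c j <= expR (s * x ord0 j * ((lo j + hi j) / 2) +
                                (s * x ord0 j) ^+ 2 * (hi j - lo j) ^+ 2 / 24).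
  by rewrite /c; have [r -> ] := uniform_on_mgf _ _ _ _ (sx j) (Cu j).
have := integral_prod_independent _ C (fun j y => expR (s * x ord0 j * y)) c
  indep.
move=> H; rewrite /mmt_gen_fun expectation_def.
have -> : (\int[P]_w ((expR \o s \o* linear_cost C x) w)%:E =
    \int[P]_w (\prod_j expR (s * x ord0 j * C j w))%:E)%E.
  apply: eq_integral => w _; congr EFin;
    rewrite /= linear_costE mulrC mulr_sumr expR_sum.
  by apply: eq_bigr => j _; rewrite mulrA.
rewrite H//; last first.
- by move=> j; apply: measurableT_comp => //; exact: measurable_funM.
rewrite lee_fin.
apply: le_trans (ler_prod _ (fun j _ => c_le j)) _.
rewrite -expR_sum ler_expR le_eqVlt; apply/orP; left; apply/eqP.
rewrite big_split /= /mean_cost /range_sqr !mulr_sumr mulr_suml; congr (_ + _).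
  by apply: eq_bigr => j _; ring.
by apply: eq_bigr => j _; ring.
Qed.

Lemma range_sqr_ge0 : 0 <= range_sqr.
Proof. by apply: sumr_ge0 => j _; rewrite mulr_ge0// sqr_ge0. Qed.

(** The Euclidean norm of a nonnegative vector is at most the sum of its entries: in the squared sum
    the diagonal terms are kept and the others are nonnegative. *)
Lemma sqrt_range_sqr_le : Num.sqrt range_sqr <= \sum_j (hi j - lo j) * x ord0 j.
Proof.
have dx j : 0 <= (hi j - lo j) * x ord0 j.
  by rewrite mulr_ge0// subr_ge0 (uniform_on_le _ _ _ (Cu j)).
have s0 : 0 <= \sum_j (hi j - lo j) * x ord0 j by apply: sumr_ge0.
rewrite -[leRHS]ger0_norm// -sqrtr_sqr; apply: ler_wsqrtr.
rewrite expr2 mulr_suml; apply: ler_sum => j _.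
rewrite -exprMn expr2 ler_wpM2l// (bigD1 j)//= lerDl.
by apply: sumr_ge0.
Qed.

(** * Two-sided bounds on the risk of a linear cost *)

Section distortion.
Context {Q : R -> R} {beta : R} (QB : BUM Q) (Qc : concave_on01 Q).
Context (betaE : beta%:E = Order.min (betaV Q) (betaH Q)).

Let hV t : R := Num.sqrt t^-1.
Let hH t : R := Num.sqrt (ln t^-1).

Let hV_ge0 : {in `]0, 1], forall t, 0 <= hV t}.
Proof. by move=> t _; exact: sqrtr_ge0. Qed.
Let hH_ge0 : {in `]0, 1], forall t, 0 <= hH t}.
Proof. by move=> t _; exact: sqrtr_ge0. Qed.

Let hV_homo : {in `]0, 1] &, {homo hV : s t /~ s <= t}}.
Proof.
move=> s t; rewrite !in_itv /= => /andP[s0 _] /andP[t0 _] ts; apply: ler_wsqrtr.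
by rewrite lef_pV2.
Qed.

Let hH_homo : {in `]0, 1] &, {homo hH : s t /~ s <= t}}.
Proof.
move=> s t; rewrite !in_itv /= => /andP[s0 _] /andP[t0 _] ts; apply: ler_wsqrtr.
by rewrite ler_ln ?posrE ?invr_gt0// lef_pV2.
Qed.

Let cV0 : 0 < (Num.sqrt 12)^-1 :> R. Proof. by rewrite invr_gt0 sqrtr_gt0. Qed.
Let cH0 : 0 < Num.sqrt 2 / 2 :> R. Proof. by rewrite divr_gt0 ?sqrtr_gt0. Qed.

Let betaVH : beta%:E = betaV Q \/ beta%:E = betaH Q.
Proof. by rewrite betaE minEle; case: ifP; [left|right]. Qed.

Lemma beta_ge0 : 0 <= beta.
Proof.
case: betaVH => bE.
  exact: (improper_RS_bound_ge0 _ QB Qc _ hV_ge0 hV_homo _ _ cV0 bE).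
exact: (improper_RS_bound_ge0 _ QB Qc _ hH_ge0 hH_homo _ _ cH0 bE).
Qed.

Lemma beta_no_jump0 : no_jump0 Q.
Proof.
case: betaVH => bE.
  by have [] := improper_RS_finite _ QB Qc _ hV_ge0 hV_homo _ _ cV0 bE.
by have [] := improper_RS_finite _ QB Qc _ hH_ge0 hH_homo _ _ cH0 bE.
Qed.

Lemma mean_cost_le_rho : mean_cost <= rho Q (linear_cost C x).
Proof.
exact: (rho_ge_expectation linear_cost_ae_bounded QB Qc _ beta_no_jump0
  linear_cost_expectation).
Qed.

Lemma mean_cost_ge0 : 0 <= mean_cost.
Proof.
apply: sumr_ge0 => j _; rewrite mulr_ge0// divr_ge0// addr_ge0//.
by rewrite (le_trans (lo0 j))// (uniform_on_le _ _ _ (Cu j)).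
Qed.

Lemma rho_le_surrogate : mutually_independent C ->
  rho Q (linear_cost C x) <= mean_cost + beta * Num.sqrt range_sqr.
Proof.
move=> indep; rewrite [beta * _]mulrC.
have mgf s s0 := linear_cost_mgf s indep s0.
have fm := VaR_onem_homo linear_cost_ae_bounded.
have m0 := mean_cost_ge0; have k0 := sqrtr_ge0 range_sqr.
case: betaVH => bE.
  apply: (RS_integral_le_improper _ QB Qc _ hV_ge0 hV_homo _ _ _ _ _ cV0 m0
    k0 bE fm).
  move=> t; rewrite in_itv /= => /andP[t0 t1].
  exact: (VaR_leV linear_cost_ae_bounded range_sqr_ge0 mgf t t0 t1).
apply: (RS_integral_le_improper _ QB Qc _ hH_ge0 hH_homo _ _ _ _ _ cH0 m0 k0
  bE fm).
move=> t; rewrite in_itv /= => /andP[t0 t1].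
exact: (VaR_leH linear_cost_ae_bounded range_sqr_ge0 mgf t t0 t1).
Qed.

End distortion.
End LinearCost.

Theorem theorem5 (R : realType)
  (I : Type) (enc : I -> seq bool)
  (real_of : seq bool -> option R)
  (vec_of : forall m : nat, seq bool -> option 'rV[R]_m)
  (n : I -> nat)
  (X : forall i : I, set 'rV[R]_(n i))
  (Q : I -> R -> R)
  (lo hi chat : forall i : I, 'I_(n i) -> R)
  (d : I -> measure_display) (T : forall i : I, measurableType (d i))
  (P : forall i : I, probability (T i) R)
  (C : forall i : I, 'I_(n i) -> {RV (P i) >-> R})
  (beta : I -> R) (gamma : R)
  (X_ge0 : forall i x, X i x -> forall j, 0 <= x ord0 j)
  (Q_BUM : forall i, BUM (Q i))
  (Q_concave : forall i, concave_on01 (Q i))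
  (C_indep : forall i, mutually_independent (C i))
  (C_unif : forall i j, uniform_on (lo i j) (hi i j) (C i j))
  (lo_ge0 : forall i j, 0 <= lo i j)
  (chatE : forall i j, ((chat i j)%:E = 'E_(P i)[C i j])%E)
  (gamma_ge : 1 / 2 <= gamma)
  (chat_ge : forall i j, gamma * (hi i j - lo i j) <= chat i j)
  (betaE : forall i, (beta i)%:E = Order.min (betaV (Q i)) (betaH (Q i)))
  (beta_poly : polytime_computable_value enc real_of beta)
  (surrogate_poly : polytime_optimizable enc vec_of X (fun i x =>
     \sum_j chat i j * x ord0 j
     + beta i * Num.sqrt (\sum_j (hi i j - lo i j) ^+ 2 * x ord0 j ^+ 2))) :
  approximable_within enc vec_of X
    (fun i x => rho (Q i) (linear_cost (C i) x))
    (fun i => 1 + beta i / gamma).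
Proof.
(* The machine solving the surrogate problem is itself the approximation algorithm. *)
case: surrogate_poly => M [p Mp]; exists M, p => i.
have [v Mv [x [vx Xx xmin]]] := Mp i.
exists v => //; exists x; split=> // y Xy.
have chatM j : chat i j = (lo i j + hi i j) / 2.
  apply: EFin_inj; rewrite chatE.
  exact: uniform_on_expectation (lo_ge0 i j) (C_unif i j).
have meanE (z : 'rV[R]_(n i)) :
    \sum_j chat i j * z ord0 j = mean_cost (lo := lo i) (hi := hi i) (x := z).
  by apply: eq_bigr => j _; rewrite chatM.
have b0 : 0 <= beta i := beta_ge0 (Q_BUM i) (Q_concave i) (betaE i).
have g0 : 0 < gamma by apply: lt_le_trans gamma_ge; rewrite divr_gt0.
have upper := rho_le_surrogate (C_unif i) (lo_ge0 i) (X_ge0 i x Xx)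
  (Q_BUM i) (Q_concave i) (betaE i) (C_indep i).
have lower := mean_cost_le_rho (C_unif i) (lo_ge0 i) (X_ge0 i y Xy)
  (Q_BUM i) (Q_concave i) (betaE i).
(* By optimality rho at x is at most the surrogate value at y; it remains to bound that value by (1
   + beta i / gamma) times the mean at y, which is at most rho at y. *)
have := xmin y Xy; rewrite !meanE => /(le_trans upper) /le_trans; apply.
have sqrt_le : Num.sqrt (range_sqr (lo := lo i) (hi := hi i) (x := y)) <=
    mean_cost (lo := lo i) (hi := hi i) (x := y) / gamma.
  apply: le_trans (sqrt_range_sqr_le (C_unif i) (X_ge0 i y Xy)) _.
  (* Here [chat_ge] compares each range with the mean, term by term. *)
  rewrite ler_pdivlMr// -meanE mulr_suml; apply: ler_sum => j _.
  by rewrite mulrAC ler_wpM2r ?(X_ge0 i y Xy)// mulrC.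
apply: (@le_trans _ _ ((1 + beta i / gamma) *
                       mean_cost (lo := lo i) (hi := hi i) (x := y))).
  by rewrite mulrDl mul1r lerD2l -mulrA ler_wpM2l// mulrC.
by rewrite ler_wpM2l// addr_ge0// divr_ge0// ltW.
Qed.
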